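(* Let $\mathcal{H}$ be a separable infinite-dimensional complex Hilbert space. Suppose that $\sigma$ is a right closed subset of $[0,1]$ with $1\in\sigma$. Then there exists a quasinilpotent operator $T\in\mathcal{B}(\mathcal{H})$ such that $\Lambda(T)=\sigma$.
   Context: An operator $T$ is quasinilpotent if $\sigma(T)=\{0\}$. For quasinilpotent $T$ and $x\neq 0$, $k_x(T)=\limsup_{\lambda\to0}\frac{\ln\|(\lambda-T)^{-1}x\|}{\ln\|(\lambda-T)^{-1}\|}$, and the power set is $\Lambda(T)=\{k_x(T): x\neq0\}$. A nonempty set $X\subseteq\mathbb{R}$ is right closed if $\sup Y\in X$ for every nonempty bounded subset $Y$ of $X$. *)

(* Defs.v *)
From Stdlib Require Import Reals ClassicalEpsilon.
From Coquelicot Require Import Coquelicot.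
Open Scope R_scope.

Fixpoint vsum_gen {V : Type} (z : V) (a : V -> V -> V) (n : nat) (f : nat -> V) : V :=
  match n with
  | O => z
  | S k => a (vsum_gen z a k f) (f k)
  end.

Record CHilbert := {
  hV :> Type;
  hzero : hV;
  hadd : hV -> hV -> hV;
  hopp : hV -> hV;
  hscal : C -> hV -> hV;
  hinner : hV -> hV -> C;
  hadd_assoc : forall x y z, hadd x (hadd y z) = hadd (hadd x y) z;
  hadd_comm : forall x y, hadd x y = hadd y x;
  hadd_zero : forall x, hadd x hzero = x;
  hadd_opp : forall x, hadd x (hopp x) = hzero;
  hscal_assoc : forall a b x, hscal a (hscal b x) = hscal (Cmult a b) x;
  hscal_one : forall x, hscal (RtoC 1) x = x;
  hscal_distr_l : forall a x y, hscal a (hadd x y) = hadd (hscal a x) (hscal a y);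
  hscal_distr_r : forall a b x, hscal (Cplus a b) x = hadd (hscal a x) (hscal b x);
  hinner_add_l : forall x y z, hinner (hadd x y) z = Cplus (hinner x z) (hinner y z);
  hinner_scal_l : forall a x y, hinner (hscal a x) y = Cmult a (hinner x y);
  hinner_conj : forall x y, hinner y x = Cconj (hinner x y);
  hinner_pos : forall x, 0 <= fst (hinner x x);
  hinner_def : forall x, hinner x x = RtoC 0 -> x = hzero;
  hcomplete : forall u : nat -> hV,
    (forall eps, 0 < eps -> exists N, forall m n, (N <= m)%nat -> (N <= n)%nat ->
        sqrt (fst (hinner (hadd (u m) (hopp (u n))) (hadd (u m) (hopp (u n))))) < eps) ->
    exists l, forall eps, 0 < eps -> exists N, forall n, (N <= n)%nat ->
        sqrt (fst (hinner (hadd (u n) (hopp l)) (hadd (u n) (hopp l)))) < eps;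
  hseparable : exists d : nat -> hV, forall x eps, 0 < eps -> exists n,
        sqrt (fst (hinner (hadd x (hopp (d n))) (hadd x (hopp (d n))))) < eps;
  hinfdim : forall n : nat, exists e : nat -> hV, forall c : nat -> C,
        vsum_gen hzero hadd n (fun i => hscal (c i) (e i)) = hzero ->
        forall i, (i < n)%nat -> c i = RtoC 0
}.

Section Ops.
Variable H : CHilbert.

Definition hnorm (x : H) : R := sqrt (fst (hinner H x x)).

Definition bounded_op (T : H -> H) : Prop :=
  (forall x y, T (hadd H x y) = hadd H (T x) (T y)) /\
  (forall a x, T (hscal H a x) = hscal H a (T x)) /\
  (exists M, forall x, hnorm (T x) <= M * hnorm x).

Definition shift_op (T : H -> H) (l : C) : H -> H :=
  fun x => hadd H (hscal H l x) (hopp H (T x)).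

Definition is_resolvent (T : H -> H) (l : C) (S : H -> H) : Prop :=
  bounded_op S /\ (forall x, S (shift_op T l x) = x) /\
  (forall x, shift_op T l (S x) = x).

Definition spectrum (T : H -> H) (l : C) : Prop :=
  ~ exists S, is_resolvent T l S.

Definition quasinilpotent (T : H -> H) : Prop :=
  bounded_op T /\ forall l, spectrum T l <-> l = RtoC 0.

(* (lambda - T)^{-1} (the unique inverse when it exists) *)
Definition resolvent (T : H -> H) (l : C) : H -> H :=
  epsilon (inhabits (fun x : H => x)) (fun S => is_resolvent T l S).

Definition opnorm (S : H -> H) : R :=
  real (Lub_Rbar (fun r => exists x, hnorm x <= 1 /\ r = hnorm (S x))).

Definition is_limsup0 (f : C -> R) (L : Rbar) : Prop :=
  (forall M : R, Rbar_lt L M ->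
     exists d, 0 < d /\ forall l, 0 < Cmod l < d -> f l < M) /\
  (forall m : R, Rbar_lt m L ->
     forall d, 0 < d -> exists l, 0 < Cmod l < d /\ m < f l).

Definition is_kx (T : H -> H) (x : H) (L : Rbar) : Prop :=
  is_limsup0 (fun l => ln (hnorm (resolvent T l x)) / ln (opnorm (resolvent T l))) L.

Definition power_set (T : H -> H) (L : Rbar) : Prop :=
  exists x, x <> hzero H /\ is_kx T x L.

End Ops.

Definition right_closed (X : R -> Prop) : Prop :=
  (exists x, X x) /\
  forall Y : R -> Prop, (forall y, Y y -> X y) -> (exists y, Y y) ->
    (exists m M, forall y, Y y -> m <= y <= M) ->
    forall s, is_lub Y s -> X s.

(* Main.v *)
(** T is a direct sum of weighted shifts T_n with weights [exp (- exp (i / r_n))], i = 0, 1, ...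
    (all zero when r_n = 0), where the r_n form a countable subset of sigma that contains 1 and
    approximates every point of sigma from the left.  With t = - ln |l|, about r_n ln t of the
    weights exceed |l|, so ln ||(l - T_n)^-1|| is at most r_n t ln t + O(t), uniformly in n, and
    r_n = 1 gives ln ||(l - T)^-1|| = t ln t + O(t).  The weights are so lacunary that, for every
    nonzero x in the n-th summand, ln ||(l - T_n)^-1 x|| >= r_n t ln t - O(t) along |l| = the k-th
    weight.  Hence k_x(T) is the supremum of the r_n over the summands in which x has a nonzero
    component, and these suprema are exactly the points of the right closed set sigma. *)

Require Import Defs.
From Stdlib Require Import Reals Lra Lia List Classical ClassicalEpsilon.
From Stdlib Require Cantor FinFun.
From Coquelicot Require Import Coquelicot.
Open Scope R_scope.

(** The doubly exponential weights make the number of relevant factors, not their sizes, decide the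
    growth. With [|l| = exp (- t)], the quotients [w_i / |l|] above 1 are those with
    [exp (i / r) < t], and the exponents [exp (i / r)] lost in their product form a geometric sum of
    order [t]. What remains is the number of factors times [t]; dividing by [t ln t] leaves [r].
    Uniformity of the error in [n] is essential, since a vector may meet infinitely many summands.
    The delicate half is the lower bound: later entries of [x] may cancel the contribution of its
    leading entry. An upper limit only asks for a sequence of [l], hence the resonant moduli. A
    point of sigma need not be one of the [r_n]; it is realised by a vector that meets exactly the
    summands with [r_n] at most that point. For an arbitrary [H], an orthonormal basis is built from
    a dense sequence and reindexed by pairs (summand, position). Norm estimates are made on finite
    square truncations, which suffices because the shift and its resolvent are lower triangular. *)

Notation rsum := (vsum_gen 0 Rplus).

(** * Finite sums and homogeneous linear systems *)

Lemma rsum_ext (n : nat) (f g : nat -> R) :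
  (forall i, (i < n)%nat -> f i = g i) -> rsum n f = rsum n g.
Proof.
  induction n as [|n IH]; intros E; simpl; [reflexivity|].
  rewrite IH, E by (intros; try apply E; lia). reflexivity.
Qed.

Lemma rsum_le (n : nat) (f g : nat -> R) :
  (forall i, (i < n)%nat -> f i <= g i) -> rsum n f <= rsum n g.
Proof.
  induction n as [|n IH]; intros E; simpl; [lra|].
  apply Rplus_le_compat; [apply IH; intros; apply E; lia | apply E; lia].
Qed.

Lemma rsum_scal (n : nat) (a : R) (f : nat -> R) :
  rsum n (fun i => a * f i) = a * rsum n f.
Proof. induction n as [|n IH]; simpl; [ring|]. rewrite IH; ring. Qed.

Lemma rsum_0 (n : nat) (f : nat -> R) :
  (forall i, (i < n)%nat -> f i = 0) -> rsum n f = 0.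
Proof.
  induction n as [|n IH]; intros E; simpl; [reflexivity|].
  rewrite IH, E by (intros; try apply E; lia). ring.
Qed.

Lemma rsum_ge0 (n : nat) (f : nat -> R) :
  (forall i, (i < n)%nat -> 0 <= f i) -> 0 <= rsum n f.
Proof.
  intros E. apply Rle_trans with (rsum n (fun _ => 0)); [|now apply rsum_le].
  right; symmetry; now apply rsum_0.
Qed.

Lemma rsum_term_le (n k : nat) (f : nat -> R) :
  (forall i, 0 <= f i) -> (k < n)%nat -> f k <= rsum n f.
Proof.
  intros F. induction n as [|n IH]; simpl; intros Hk; [lia|].
  pose proof (F n).
  destruct (Nat.eq_dec k n) as [->|Hne].
  - pose proof (rsum_ge0 n f ltac:(auto)). lra.
  - specialize (IH ltac:(lia)). lra.
Qed.

Lemma rsum_incr (m n : nat) (f : nat -> R) :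
  (forall i, 0 <= f i) -> (m <= n)%nat -> rsum m f <= rsum n f.
Proof.
  intros F Hmn. induction Hmn as [|n Hmn IH]; simpl; [lra|]. pose proof (F n); lra.
Qed.

Lemma sq_le_inv (x y : R) : 0 <= y -> x ^ 2 <= y ^ 2 -> x <= y.
Proof. intros; nra. Qed.

Lemma sq_lt_inv (x y : R) : 0 <= y -> x ^ 2 < y ^ 2 -> x < y.
Proof. intros; nra. Qed.

Notation csum := (vsum_gen (RtoC 0) Cplus).

Lemma csum_ext (n : nat) (f g : nat -> C) :
  (forall i, (i < n)%nat -> f i = g i) -> csum n f = csum n g.
Proof.
  induction n as [|n IH]; intros E; simpl; [reflexivity|].
  rewrite IH, E by (intros; try apply E; lia). reflexivity.
Qed.

Lemma csum_lin (n : nat) (a : C) (f g : nat -> C) :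
  csum n (fun i => Cplus (f i) (Cmult a (g i))) = Cplus (csum n f) (Cmult a (csum n g)).
Proof. induction n as [|n IH]; simpl; [ring|]. rewrite IH; ring. Qed.

Lemma csum_0 (n : nat) (f : nat -> C) :
  (forall i, (i < n)%nat -> f i = RtoC 0) -> csum n f = RtoC 0.
Proof.
  induction n as [|n IH]; intros E; simpl; [reflexivity|].
  rewrite IH, E by (intros; try apply E; lia). ring.
Qed.

(** [bump p] enumerates in order the indices other than [p]; it serves to delete the unknown [p]
    from a linear system. *)
Definition bump (p i : nat) : nat := if Compare_dec.lt_dec i p then i else S i.
Definition unbump (p i : nat) : nat := if Compare_dec.lt_dec i p then i else pred i.

Lemma bumpK (p i : nat) : unbump p (bump p i) = i.
Proof.
  unfold bump, unbump.
  destruct (Compare_dec.lt_dec i p); [destruct (Compare_dec.lt_dec i p); lia|].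
  destruct (Compare_dec.lt_dec (S i) p); lia.
Qed.

Lemma bump_neq (p i : nat) : bump p i <> p.
Proof. unfold bump; destruct (Compare_dec.lt_dec i p); lia. Qed.

Lemma csum_bump (n p : nat) (f : nat -> C) :
  (p <= n)%nat -> csum (S n) f = Cplus (f p) (csum n (fun i => f (bump p i))).
Proof.
  induction n as [|n IH]; intros Hp.
  - replace p with 0%nat by lia. simpl. ring.
  - destruct (Nat.eq_dec p (S n)) as [->|Hne].
    + change (csum (S (S n)) f) with (Cplus (csum (S n) f) (f (S n))).
      rewrite (csum_ext (S n) (fun i => f (bump (S n) i)) f); [ring|].
      intros i Hi. unfold bump. destruct (Compare_dec.lt_dec i (S n)); [reflexivity|lia].
    + change (csum (S (S n)) f) with (Cplus (csum (S n) f) (f (S n))).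
      rewrite IH by lia. simpl.
      replace (bump p n) with (S n); [ring|].
      unfold bump. destruct (Compare_dec.lt_dec n p); lia.
Qed.

(** Gaussian elimination. If some unknown [p] has a nonzero coefficient in the last equation, that
    equation is solved for it and substituted into the others; if none has, the last equation is
    void and the last unknown is set to zero. *)
Lemma homogeneous_solution (n : nat) (a : nat -> nat -> C) :
  exists c : nat -> C, (exists i, (i <= n)%nat /\ c i <> RtoC 0) /\
    forall j, (j < n)%nat -> csum (S n) (fun i => Cmult (c i) (a i j)) = RtoC 0.
Proof.
  revert a. induction n as [|n IH]; intros a.
  { exists (fun _ => RtoC 1). split; [|intros; lia].
    exists 0%nat. split; [lia|]. intros E; injection E; lra. }
  destruct (classic (exists p, (p <= S n)%nat /\ a p n <> RtoC 0)) as [[p [Hp Ap]]|Hno].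
  - destruct (IH (fun i j => Cplus (a (bump p i) j)
                   (Cmult (Copp (Cdiv (a p j) (a p n))) (a (bump p i) n))))
      as [c [[i [Hi Ci]] Hc]].
    set (q := csum (S n) (fun i => Cmult (c i) (a (bump p i) n))).
    exists (fun k => if Nat.eq_dec k p then Copp (Cdiv q (a p n)) else c (unbump p k)).
    assert (Hsum : forall j, csum (S (S n)) (fun k => Cmult
       (if Nat.eq_dec k p then Copp (Cdiv q (a p n)) else c (unbump p k)) (a k j))
       = Cplus (Cmult (Copp (Cdiv q (a p n))) (a p j))
               (csum (S n) (fun i => Cmult (c i) (a (bump p i) j)))).
    { intros j. rewrite (csum_bump _ p) by lia. f_equal.
      - destruct (Nat.eq_dec p p); [reflexivity|lia].
      - apply csum_ext. intros k _. pose proof (bump_neq p k).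
        destruct (Nat.eq_dec (bump p k) p); [lia|]. now rewrite bumpK. }
    split.
    + exists (bump p i). split; [unfold bump; destruct (Compare_dec.lt_dec i p); lia|].
      pose proof (bump_neq p i). destruct (Nat.eq_dec (bump p i) p); [lia|].
      now rewrite bumpK.
    + intros j Hj. rewrite Hsum. destruct (Nat.eq_dec j n) as [->|Hne].
      * fold q. field. exact Ap.
      * specialize (Hc j ltac:(lia)).
        rewrite (csum_ext (S n) _ (fun i => Cplus (Cmult (c i) (a (bump p i) j))
           (Cmult (Copp (Cdiv (a p j) (a p n))) (Cmult (c i) (a (bump p i) n)))))
          in Hc by (intros; ring).
        rewrite csum_lin in Hc. fold q in Hc. etransitivity; [|exact Hc]. field. exact Ap.
  - destruct (IH a) as [c [[i [Hi Ci]] Hc]].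
    exists (fun k => if Nat.eq_dec k (S n) then RtoC 0 else c k). split.
    + exists i. split; [lia|]. destruct (Nat.eq_dec i (S n)); [lia|exact Ci].
    + intros j Hj. destruct (Nat.eq_dec j n) as [->|Hne].
      * apply csum_0. intros k Hk. replace (a k n) with (RtoC 0); [ring|].
        apply NNPP. intros Hk0. apply Hno. exists k. split; [lia|congruence].
      * change (csum (S (S n)) ?f) with (Cplus (csum (S n) f) (f (S n))). cbv beta.
        destruct (Nat.eq_dec (S n) (S n)); [|lia].
        transitivity (Cplus (csum (S n) (fun i => Cmult (c i) (a i j)))
                            (Cmult (RtoC 0) (a (S n) j))).
        { f_equal. apply csum_ext. intros k Hk.
          destruct (Nat.eq_dec k (S n)); [lia|reflexivity]. }
        rewrite Hc by lia. ring.
Qed.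

(** * Orthonormal bases *)

Section HilbertBasis.

Variable H : CHilbert.

Local Notation "x +! y" := (hadd H x y) (at level 50, left associativity).
Local Notation "a *! x" := (hscal H a x) (at level 40, left associativity).
Local Notation "-! x" := (hopp H x) (at level 35, right associativity).
Local Notation "<| x , y |>" := (hinner H x y) (at level 0, x, y at level 99).
Local Notation vsum := (vsum_gen (hzero H) (hadd H)).

Definition nsq (x : H) : R := Re (hinner H x x).

Lemma hadd_zero_l (x : H) : hzero H +! x = x.
Proof. now rewrite hadd_comm, hadd_zero. Qed.

Lemma hadd_cancel (x y z : H) : x +! y = x +! z -> y = z.
Proof.
  intros E. rewrite <- (hadd_zero_l y), <- (hadd_zero_l z), <- (hadd_opp H x).
  rewrite (hadd_comm H x), <- !hadd_assoc. now rewrite E.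
Qed.

Lemma hscal_zero_l (x : H) : RtoC 0 *! x = hzero H.
Proof.
  apply (hadd_cancel (RtoC 0 *! x)). rewrite <- hscal_distr_r, hadd_zero.
  f_equal. ring.
Qed.

Lemma hopp_scal (x : H) : -! x = RtoC (-1) *! x.
Proof.
  apply (hadd_cancel x). rewrite hadd_opp, <- (hscal_zero_l x).
  transitivity (RtoC 1 *! x +! RtoC (-1) *! x); [|now rewrite hscal_one].
  rewrite <- hscal_distr_r. f_equal. rewrite <- RtoC_plus. f_equal. ring.
Qed.

Lemma hsub_zero (x y : H) : x +! -! y = hzero H -> x = y.
Proof.
  intros E. apply (hadd_cancel (-! y)).
  rewrite (hadd_comm H _ x), (hadd_comm H _ y), E. symmetry. apply hadd_opp.
Qed.

Lemma hsub_add (x y : H) : (x +! -! y) +! y = x.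
Proof. now rewrite <- hadd_assoc, (hadd_comm H (-! y)), hadd_opp, hadd_zero. Qed.

Lemma inner_zero_l (x : H) : <| hzero H, x |> = RtoC 0.
Proof. rewrite <- (hscal_zero_l x), hinner_scal_l. ring. Qed.

Lemma inner_opp_l (x y : H) : <| -! x, y |> = Copp <| x, y |>.
Proof. rewrite hopp_scal, hinner_scal_l.
  replace (RtoC (-1)) with (Copp (RtoC 1)); [ring|]. rewrite <- RtoC_opp. f_equal. Qed.

Lemma inner_sub_l (x y z : H) : <| x +! -! y, z |> = Cminus <| x, z |> <| y, z |>.
Proof. rewrite hinner_add_l, inner_opp_l. ring. Qed.

Lemma inner_add_r (x y z : H) : <| x, y +! z |> = Cplus <| x, y |> <| x, z |>.
Proof.
  rewrite hinner_conj, hinner_add_l, Cplus_conj, <- !hinner_conj. reflexivity.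
Qed.

Lemma inner_scal_r (a : C) (x y : H) : <| x, a *! y |> = Cmult (Cconj a) <| x, y |>.
Proof. rewrite hinner_conj, hinner_scal_l, Cmult_conj, <- !hinner_conj. reflexivity. Qed.

Lemma inner_self (x : H) : <| x, x |> = RtoC (nsq x).
Proof.
  pose proof (hinner_conj H x x) as E. unfold nsq.
  destruct (<| x, x |>) as [u v]. unfold Cconj in E; simpl in *.
  injection E as E. unfold RtoC. f_equal. lra.
Qed.

Lemma inner_sym0 (x y : H) : <| x, y |> = RtoC 0 -> <| y, x |> = RtoC 0.
Proof. intros E. rewrite hinner_conj, E. unfold Cconj, RtoC; simpl. f_equal; ring. Qed.

Lemma nsq_ge0 (x : H) : 0 <= nsq x.
Proof. apply hinner_pos. Qed.

Lemma nsq_eq0 (x : H) : nsq x = 0 -> x = hzero H.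
Proof. intros E. apply hinner_def. now rewrite inner_self, E. Qed.

Lemma nsq_scal (a : C) (x : H) : nsq (a *! x) = Cmod a ^ 2 * nsq x.
Proof.
  unfold nsq at 1. rewrite hinner_scal_l, inner_scal_r, inner_self.
  rewrite Cmult_assoc, <- Cmod2_conj, <- RtoC_mult. reflexivity.
Qed.

Lemma nsq_opp (x : H) : nsq (-! x) = nsq x.
Proof.
  rewrite hopp_scal, nsq_scal, Cmod_R, <- (Rabs_Ropp), Rabs_right by lra. ring.
Qed.

Lemma pythagoras (x y : H) : <| x, y |> = RtoC 0 -> nsq (x +! y) = nsq x + nsq y.
Proof.
  intros E. unfold nsq at 1.
  rewrite hinner_add_l, !inner_add_r, E, (inner_sym0 _ _ E), !inner_self.
  rewrite Cplus_0_r, Cplus_0_l, <- RtoC_plus. reflexivity.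
Qed.

Lemma hnorm_sq (x : H) : hnorm H x ^ 2 = nsq x.
Proof. unfold hnorm. rewrite <- Rsqr_pow2. apply Rsqr_sqrt, hinner_pos. Qed.

Lemma hnorm_ge0 (x : H) : 0 <= hnorm H x.
Proof. apply sqrt_pos. Qed.

Lemma hadd_swap (x y z w : H) : (x +! y) +! (z +! w) = (x +! z) +! (y +! w).
Proof.
  rewrite <- !hadd_assoc. f_equal. rewrite !hadd_assoc. f_equal. apply hadd_comm.
Qed.

Definition ON (n : nat) (e : nat -> H) : Prop :=
  forall i j, (i < n)%nat -> (j < n)%nat ->
    <| e i, e j |> = if Nat.eq_dec i j then RtoC 1 else RtoC 0.

(** For orthonormal [e], the component of [x] orthogonal to [e 0, ..., e (n - 1)]. *)
Fixpoint residual (e : nat -> H) (n : nat) (x : H) : H :=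
  match n with
  | O => x
  | S k => residual e k x +! Copp <| x, e k |> *! e k
  end.

Lemma residual_ext (e f : nat -> H) (n : nat) (x : H) :
  (forall i, (i < n)%nat -> e i = f i) -> residual e n x = residual f n x.
Proof.
  induction n as [|n IH]; intros E; simpl; [reflexivity|].
  rewrite IH, E by (intros; try apply E; lia). reflexivity.
Qed.

Lemma residual_add (e : nat -> H) (n : nat) (x y : H) :
  residual e n (x +! y) = residual e n x +! residual e n y.
Proof.
  induction n as [|n IH]; simpl; [reflexivity|].
  rewrite IH, hadd_swap, <- hscal_distr_r, hinner_add_l. do 2 f_equal. ring.
Qed.

Lemma residual_inner (e : nat -> H) (n m j : nat) (x : H) :
  ON n e -> (m <= n)%nat -> (j < n)%nat ->
  <| residual e m x, e j |> = if Compare_dec.lt_dec j m then RtoC 0 else <| x, e j |>.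
Proof.
  intros He. induction m as [|m IH]; intros Hm Hj; simpl.
  - destruct (Compare_dec.lt_dec j 0); [lia|reflexivity].
  - rewrite hinner_add_l, hinner_scal_l, IH, He by lia.
    destruct (Compare_dec.lt_dec j m), (Nat.eq_dec m j), (Compare_dec.lt_dec j (S m));
      try lia; subst; ring.
Qed.

(** Each step splits off [<x, e m> e m], orthogonal to the next residual. The exact remainder is
    kept, rather than an inequality, because completeness of the basis is proved by comparing
    remainders. *)
Lemma bessel (e : nat -> H) (n m : nat) (x : H) :
  ON n e -> (m <= n)%nat ->
  nsq x = nsq (residual e m x) + rsum m (fun i => Cmod <| x, e i |> ^ 2).
Proof.
  intros He. induction m as [|m IH]; intros Hm; [simpl; ring|].
  rewrite IH by lia.
  replace (residual e m x) with (residual e (S m) x +! <| x, e m |> *! e m).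
  - rewrite pythagoras, nsq_scal.
    + cut (nsq (e m) = 1); [intros ->; simpl; ring|].
      unfold nsq. rewrite He by lia. destruct (Nat.eq_dec m m); [reflexivity|lia].
    + rewrite inner_scal_r, (residual_inner e n) by (auto; lia).
      destruct (Compare_dec.lt_dec m (S m)); [ring|lia].
  - simpl. rewrite <- hadd_assoc, <- hscal_distr_r.
    replace (Cplus _ _) with (RtoC 0) by ring.
    now rewrite hscal_zero_l, hadd_zero.
Qed.

Lemma vsum_inner (n : nat) (c : nat -> C) (f : nat -> H) (y : H) :
  <| vsum n (fun i => c i *! f i), y |>
  = vsum_gen (RtoC 0) Cplus n (fun i => Cmult (c i) <| f i, y |>).
Proof.
  induction n as [|n IH]; simpl; [apply inner_zero_l|].
  now rewrite hinner_add_l, IH, hinner_scal_l.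
Qed.

Definition orthonormal (e : nat -> H) : Prop :=
  forall i j, <| e i, e j |> = if Nat.eq_dec i j then RtoC 1 else RtoC 0.

Lemma orthonormal_ON (e : nat -> H) (n : nat) : orthonormal e -> ON n e.
Proof. intros He i j _ _. apply He. Qed.

Lemma normalize (x : H) : x <> hzero H -> exists a v, nsq v = 1 /\ x = a *! v /\
  forall y, <| x, y |> = RtoC 0 -> <| v, y |> = RtoC 0.
Proof.
  intros Hx.
  assert (P : 0 < nsq x).
  { destruct (nsq_ge0 x) as [P|E]; [exact P|]. now elim Hx; apply nsq_eq0. }
  assert (Q : 0 < sqrt (nsq x)) by now apply sqrt_lt_R0.
  exists (RtoC (sqrt (nsq x))), (RtoC (/ sqrt (nsq x)) *! x). repeat split.
  - rewrite nsq_scal, Cmod_R, Rabs_right by (apply Rle_ge, Rlt_le, Rinv_0_lt_compat, Q).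
    rewrite <- (sqrt_def (nsq x)) at 2 by lra. field. lra.
  - rewrite hscal_assoc, <- RtoC_mult, Rinv_r, hscal_one by lra. reflexivity.
  - intros y E. rewrite hinner_scal_l, E. ring.
Qed.

(** Orthogonality to [n] vectors is a system of [n] equations for the coefficients of a combination
    of [n + 1] independent vectors, so a nontrivial solution exists; independence makes the
    combination nonzero. *)
Lemma unit_orthogonal (n : nat) (e : nat -> H) :
  exists v, nsq v = 1 /\ forall i, (i < n)%nat -> <| v, e i |> = RtoC 0.
Proof.
  destruct (hinfdim H (S n)) as [f Hf].
  destruct (homogeneous_solution n (fun i j => <| f i, e j |>)) as [c [[i [Hi Ci]] Hc]].
  destruct (normalize (vsum (S n) (fun i => c i *! f i))) as [a [v [V1 [_ V2]]]].
  - intros E. apply Ci, (Hf c E). lia.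
  - exists v. split; [exact V1|]. intros j Hj. apply V2. rewrite vsum_inner. now apply Hc.
Qed.

(* A residual that already vanishes is replaced by an arbitrary orthogonal unit vector, so that
   no vector of the basis is zero. *)
Lemma gram_schmidt_step (n : nat) (e : nat -> H) (d : H) :
  exists v, nsq v = 1 /\ (ON n e ->
    (forall i, (i < n)%nat -> <| v, e i |> = RtoC 0) /\
    exists a, residual e n d = a *! v).
Proof.
  destruct (classic (residual e n d = hzero H)) as [E|E].
  - destruct (unit_orthogonal n e) as [v [V1 V2]]. exists v. split; [exact V1|].
    intros _. split; [exact V2|]. exists (RtoC 0). now rewrite hscal_zero_l.
  - destruct (normalize _ E) as [a [v [V1 [V2 V3]]]]. exists v. split; [exact V1|].
    intros He. split; [|now exists a].
    intros i Hi. apply V3. rewrite (residual_inner e n) by (auto; lia).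
    destruct (Compare_dec.lt_dec i n); [reflexivity|lia].
Qed.

(** Course-of-values recursion: the [n]-th stage holds the first [n] vectors, and zero beyond, so
    that [pick] can see all earlier choices. *)
Fixpoint extend (pick : nat -> (nat -> H) -> H) (n : nat) : nat -> H :=
  match n with
  | O => fun _ => hzero H
  | S k => fun i => if Nat.eq_dec i k then pick k (extend pick k) else extend pick k i
  end.

Lemma extend_lt (pick : nat -> (nat -> H) -> H) (n i : nat) :
  (i < n)%nat -> extend pick n i = extend pick (S i) i.
Proof.
  induction n as [|n IH]; intros Hi; [lia|].
  destruct (Nat.eq_dec i n) as [->|Hne]; [reflexivity|].
  rewrite <- IH by lia. simpl. destruct (Nat.eq_dec i n); [lia|reflexivity].
Qed.

Lemma gram_schmidt (d : nat -> H) :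
  exists e, orthonormal e /\ forall n, residual e (S n) (d n) = hzero H.
Proof.
  (* Orthonormality is a premise inside [gram_schmidt_step], so a vector can be picked for every [e]
     and the recursion is defined before anything is known about its values. *)
  set (pick := fun n e => proj1_sig (constructive_indefinite_description _
                 (gram_schmidt_step n e (d n)))).
  assert (Hpick : forall n e, nsq (pick n e) = 1 /\ (ON n e ->
    (forall i, (i < n)%nat -> <| pick n e, e i |> = RtoC 0) /\
    exists a, residual e n (d n) = a *! pick n e)).
  { intros n e. apply (proj2_sig (constructive_indefinite_description _
                 (gram_schmidt_step n e (d n)))). }
  clearbody pick.
  set (e := fun i => extend pick (S i) i).
  assert (Hext : forall n i, (i < n)%nat -> extend pick n i = e i)
    by (intros; now apply extend_lt).
  assert (He : forall n, e n = pick n (extend pick n)).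
  { intros n. unfold e. simpl. destruct (Nat.eq_dec n n); [reflexivity|lia]. }
  assert (ONext : forall n, ON n e -> ON n (extend pick n)).
  { intros n Hn i j Hi Hj. rewrite !Hext by assumption. now apply Hn. }
  assert (HON : forall n, ON n e).
  { induction n as [|n IH]; [intros i j; lia|].
    destruct (Hpick n (extend pick n)) as [P1 P2].
    destruct (P2 (ONext n IH)) as [P3 _]. rewrite <- He in *.
    assert (P4 : forall i, (i < n)%nat -> <| e n, e i |> = RtoC 0).
    { intros i Hi. rewrite <- (Hext n i) by assumption. now apply P3. }
    intros i j Hi Hj.
    destruct (Nat.eq_dec i n) as [->|Hin], (Nat.eq_dec j n) as [->|Hjn].
    - destruct (Nat.eq_dec n n); [|lia]. now rewrite inner_self, P1.
    - destruct (Nat.eq_dec n j); [lia|]. apply P4; lia.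
    - destruct (Nat.eq_dec i n); [lia|]. apply inner_sym0, P4; lia.
    - apply IH; lia. }
  exists e. split.
  - intros i j. apply (HON (S (i + j))); lia.
  - intros n. destruct (Hpick n (extend pick n)) as [P1 P2].
    destruct (P2 (ONext n (HON n))) as [_ [a P3]]. rewrite <- He in *.
    rewrite (residual_ext _ e) in P3 by (intros; now apply Hext).
    assert (E : <| d n, e n |> = a).
    { pose proof (residual_inner e (S n) n n (d n) (HON _) ltac:(lia) ltac:(lia)) as E.
      destruct (Compare_dec.lt_dec n n); [lia|].
      rewrite <- E, P3, hinner_scal_l, inner_self, P1. ring. }
    simpl. rewrite E, P3, <- hscal_distr_r.
    replace (Cplus _ _) with (RtoC 0) by ring. apply hscal_zero_l.
Qed.

(** The nontrivial half of Parseval, phrased with bounds on partial sums to avoid series. Since the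
    residual of [d n] is zero, [x] and [x - d n] have the same residual, whose norm is at most
    [|x - d n|] and hence arbitrarily small. *)
Lemma separable_basis : exists e, orthonormal e /\
  forall x B, (forall n, rsum n (fun i => Cmod <| x, e i |> ^ 2) <= B) -> nsq x <= B.
Proof.
  destruct (hseparable H) as [d Hd].
  destruct (gram_schmidt d) as [e [He Hr]]. exists e. split; [exact He|].
  intros x B HB. apply le_epsilon. intros eps Heps.
  destruct (Hd x (sqrt eps)) as [n Hn]; [now apply sqrt_lt_R0|].
  assert (Hlt : nsq (x +! -! d n) <= eps).
  { apply Rlt_le, sqrt_lt_0_alt, Hn. }
  rewrite (bessel e (S n) (S n) x (orthonormal_ON e _ He) (le_n _)).
  rewrite (bessel e (S n) (S n) (_ +! _) (orthonormal_ON e _ He) (le_n _)) in Hlt.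
  assert (E : residual e (S n) x = residual e (S n) (x +! -! d n)).
  { rewrite <- (hsub_add x (d n)) at 1. now rewrite residual_add, Hr, hadd_zero. }
  rewrite E. specialize (HB (S n)).
  pose proof (rsum_ge0 (S n) (fun i => Cmod <| x +! -! d n, e i |> ^ 2)
    ltac:(intros; apply pow2_ge_0)). lra.
Qed.

Lemma inner_basis_le (e : nat -> H) (x : H) (n : nat) :
  orthonormal e -> rsum n (fun i => Cmod <| x, e i |> ^ 2) <= nsq x.
Proof.
  intros He. rewrite (bessel e n n x (orthonormal_ON e _ He) (le_n _)).
  pose proof (nsq_ge0 (residual e n x)). lra.
Qed.

(** Squared distances of the partial sums [u] are differences of the bounded increasing sequence
    [s], so [u] is Cauchy; coefficients pass to the limit by Bessel. *)
Lemma riesz_fischer (e : nat -> H) (c : nat -> C) (B : R) :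
  orthonormal e -> (forall n, rsum n (fun i => Cmod (c i) ^ 2) <= B) ->
  exists x, forall i, <| x, e i |> = c i.
Proof.
  intros He HB.
  set (u := fun n => vsum n (fun i => c i *! e i)).
  set (s := fun n => rsum n (fun i => Cmod (c i) ^ 2)).
  assert (Hu : forall n k, <| u n, e k |>
               = if Compare_dec.lt_dec k n then c k else RtoC 0).
  { intros n k. induction n as [|n IH]; [apply inner_zero_l|].
    change (u (S n)) with (u n +! c n *! e n). rewrite hinner_add_l, hinner_scal_l, IH, He.
    destruct (Compare_dec.lt_dec k n), (Nat.eq_dec n k), (Compare_dec.lt_dec k (S n));
      try lia; subst; ring. }
  assert (Hd : forall n m, (n <= m)%nat -> nsq (u m +! -! u n) = s m - s n).
  { intros n m Hnm. induction Hnm as [|m Hnm IH].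
    - rewrite hadd_opp. unfold nsq. rewrite inner_zero_l. simpl. ring.
    - replace (u (S m) +! -! u n) with ((u m +! -! u n) +! c m *! e m).
      + rewrite pythagoras, IH, nsq_scal.
        * unfold nsq. rewrite He. destruct (Nat.eq_dec m m); [|lia].
          unfold s; simpl; ring.
        * rewrite inner_scal_r, inner_sub_l, !Hu.
          destruct (Compare_dec.lt_dec m m), (Compare_dec.lt_dec m n); try lia. ring.
      + change (u (S m)) with (u m +! c m *! e m). rewrite <- !hadd_assoc.
        f_equal. apply hadd_comm. }
  assert (Hs : Cauchy_crit s).
  { apply CV_Cauchy, growing_cv.
    - intros n. apply rsum_incr; [intros; apply pow2_ge_0|lia].
    - exists B. intros r [n ->]. apply HB. }
  assert (Hsym : forall x y, nsq (x +! -! y) = nsq (y +! -! x)).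
  { intros x y. rewrite <- nsq_opp. f_equal. apply (hadd_cancel (x +! -! y)).
    now rewrite hadd_opp, hadd_assoc, hsub_add, hadd_opp. }
  destruct (hcomplete H u) as [x Hx].
  - intros eps Heps. destruct (Hs (eps ^ 2)) as [N HN]; [now apply pow_lt|].
    exists N.
    assert (W : forall m n, (N <= m)%nat -> (m <= n)%nat -> hnorm H (u n +! -! u m) < eps).
    { intros m n Hm Hmn. apply sq_lt_inv; [now left|].
      rewrite hnorm_sq, Hd by exact Hmn. specialize (HN n m ltac:(lia) ltac:(lia)).
      unfold R_dist in HN. apply Rle_lt_trans with (2 := HN), Rle_abs. }
    intros m n Hm Hn.
    destruct (Nat.le_ge_cases n m) as [Hmn|Hmn].
    + now apply W.
    + change (hnorm H (u m +! -! u n) < eps).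
      replace (hnorm H (u m +! -! u n)) with (hnorm H (u n +! -! u m)); [now apply W|].
      unfold hnorm. f_equal. symmetry. apply Hsym.
  - exists x. intros k.
    assert (E : Cminus (c k) <| x, e k |> = RtoC 0).
    { apply Cmod_eq_0, Rle_antisym; [|apply Cmod_ge_0].
      apply le_epsilon. intros eps Heps. rewrite Rplus_0_l.
      destruct (Hx eps Heps) as [N HN].
      (* This index exceeds both [N] and [k], so the [k]-th coefficient of the partial sum is
         already [c k]. *)
      specialize (HN (S (N + k)) ltac:(lia)). change (hnorm H (u (S (N + k)) +! -! x) < eps) in HN.
      apply Rle_trans with (2 := Rlt_le _ _ HN).
      apply sq_le_inv; [apply hnorm_ge0|]. rewrite hnorm_sq.
      pose proof (inner_basis_le e (u (S (N + k)) +! -! x) (S k) He) as L.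
      pose proof (rsum_term_le (S k) k (fun i => Cmod <| u (S (N + k)) +! -! x, e i |> ^ 2)
        ltac:(intros; apply pow2_ge_0) ltac:(lia)) as L'.
      cbv beta in L'. rewrite inner_sub_l, Hu in L'.
      destruct (Compare_dec.lt_dec k (S (N + k))); [|lia]. lra. }
    apply (f_equal (fun z => Cplus z <| x, e k |>)) in E.
    replace (c k) with (Cplus (Cminus (c k) <| x, e k |>) <| x, e k |>) by ring.
    rewrite E. ring.
Qed.

End HilbertBasis.

(** * Coordinates indexed by pairs *)

Definition lsum (f : nat -> R) (l : list nat) : R := fold_right (fun a s => f a + s) 0 l.

Lemma lsum_app (f : nat -> R) (l l' : list nat) :
  lsum f (l ++ l') = lsum f l + lsum f l'.
Proof. induction l as [|a l IH]; simpl; [ring|]. rewrite IH; ring. Qed.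

Lemma rsum_lsum (n : nat) (f : nat -> R) : rsum n f = lsum f (seq 0 n).
Proof.
  induction n as [|n IH]; [reflexivity|].
  rewrite seq_S, lsum_app. simpl. rewrite IH; ring.
Qed.

Lemma lsum_incl (f : nat -> R) (l l' : list nat) :
  (forall i, 0 <= f i) -> NoDup l -> incl l l' -> lsum f l <= lsum f l'.
Proof.
  intros F Hl. revert l'. induction Hl as [|a l Ha Hl IH]; intros l' Hi.
  - clear Hi. induction l' as [|b l' IH]; simpl; [lra|]. simpl in IH. pose proof (F b). lra.
  - destruct (in_split a l') as [l1 [l2 ->]]; [apply Hi; now left|].
    specialize (IH (l1 ++ l2)). rewrite lsum_app in *. simpl.
    cut (incl l (l1 ++ l2)); [intros I; specialize (IH I); lra|].
    intros b Hb. specialize (Hi b (or_intror Hb)). apply in_app_iff in Hi.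
    apply in_app_iff. destruct Hi as [Hi|[->|Hi]]; [now left|contradiction|now right].
Qed.

Lemma rsum_prod (g : nat -> R) (t : nat * nat -> nat) (m n : nat) :
  rsum m (fun i => rsum n (fun j => g (t (i, j))))
  = lsum g (map t (list_prod (seq 0 m) (seq 0 n))).
Proof.
  rewrite rsum_lsum. induction (seq 0 m) as [|a l IH]; [reflexivity|].
  simpl. rewrite map_app, lsum_app, <- IH.
  f_equal. rewrite rsum_lsum. clear IH.
  induction (seq 0 n) as [|b l' IH]; [reflexivity|]. simpl. now rewrite IH.
Qed.

Lemma NoDup_list_prod (A B : Type) (l : list A) (l' : list B) :
  NoDup l -> NoDup l' -> NoDup (list_prod l l').
Proof.
  intros Hl Hl'. induction Hl as [|a l Ha Hl IH]; simpl; [constructor|].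
  apply NoDup_app; [|exact IH|].
  - apply FinFun.Injective_map_NoDup; [|exact Hl']. intros b b' E. now injection E.
  - intros [a' b] H1 H2. apply in_map_iff in H1. destruct H1 as [b' [E _]].
    injection E as -> ->. apply in_prod_iff in H2. tauto.
Qed.

(** The Cantor code of a pair is at least either component, so indices below [K] come from pairs
    below [K]. Together with [square_le_rsum], bounds on initial segments and bounds on squares
    become interchangeable. *)
Lemma rsum_le_square (g : nat -> R) (K : nat) : (forall i, 0 <= g i) ->
  rsum K g <= rsum K (fun i => rsum K (fun j => g (Cantor.to_nat (i, j)))).
Proof.
  intros Hg. rewrite rsum_prod, rsum_lsum. apply lsum_incl; [exact Hg|apply seq_NoDup|].
  intros k Hk. apply in_seq in Hk. apply in_map_iff.
  exists (Cantor.of_nat k). split; [apply Cantor.cancel_to_of|].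
  destruct (Cantor.of_nat k) as [i j] eqn:E.
  pose proof (Cantor.to_nat_non_decreasing i j) as L.
  rewrite <- E, Cantor.cancel_to_of in L.
  apply in_prod; apply in_seq; lia.
Qed.

Lemma square_le_rsum (g : nat -> R) (N : nat) : (forall i, 0 <= g i) -> exists K,
  rsum N (fun i => rsum N (fun j => g (Cantor.to_nat (i, j)))) <= rsum K g.
Proof.
  intros Hg. exists (S (Cantor.to_nat (N, N))). rewrite rsum_prod, rsum_lsum.
  apply lsum_incl; [exact Hg| |].
  - apply FinFun.Injective_map_NoDup; [exact Cantor.to_nat_inj|].
    apply NoDup_list_prod; apply seq_NoDup.
  - intros k Hk. apply in_map_iff in Hk. destruct Hk as [[i j] [<- Hk]].
    apply in_prod_iff in Hk. rewrite !in_seq in Hk. apply in_seq.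
    pose proof (Cantor.to_nat_spec i j). pose proof (Cantor.to_nat_spec N N). nia.
Qed.

Definition sqsum (N : nat) (f : nat -> nat -> C) : R :=
  rsum N (fun n => rsum N (fun j => Cmod (f n j) ^ 2)).

(** An isometric isomorphism with the square summable double sequences, expressed by bounds on
    finite squares. The first index is the summand, the second the position within it. *)
Record coordinates (H : CHilbert) (co : H -> nat -> nat -> C) : Prop := {
  co_add : forall x y n j, co (hadd H x y) n j = Cplus (co x n j) (co y n j);
  co_scal : forall a x n j, co (hscal H a x) n j = Cmult a (co x n j);
  co_le : forall x N, sqsum N (co x) <= nsq H x;
  co_ge : forall x B, (forall N, sqsum N (co x) <= B) -> nsq H x <= B;
  co_surj : forall f B, (forall N, sqsum N f <= B) -> exists x, forall n j, co x n j = f n j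
}.

Lemma coordinates_exist (H : CHilbert) : exists co, coordinates H co.
Proof.
  destruct (separable_basis H) as [e [He Hc]].
  exists (fun x n j => hinner H x (e (Cantor.to_nat (n, j)))). split.
  - intros; apply hinner_add_l.
  - intros; apply hinner_scal_l.
  - intros x N.
    destruct (square_le_rsum (fun k => Cmod (hinner H x (e k)) ^ 2) N) as [K HK];
      [intros; apply pow2_ge_0|].
    apply Rle_trans with (1 := HK). now apply inner_basis_le.
  - intros x B HB. apply Hc. intros K. apply Rle_trans with (2 := HB K).
    apply (rsum_le_square (fun k => Cmod (hinner H x (e k)) ^ 2)).
    intros; apply pow2_ge_0.
  - intros f B HB.
    destruct (riesz_fischer H e (fun k => f (fst (Cantor.of_nat k)) (snd (Cantor.of_nat k))) B He)
      as [x Hx].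
    + intros K. eapply Rle_trans; [|apply (HB K)].
      eapply Rle_trans; [apply rsum_le_square; intros; apply pow2_ge_0|].
      right. apply rsum_ext; intros i _; apply rsum_ext; intros j _.
      now rewrite Cantor.cancel_of_to.
    + exists x. intros n j. now rewrite Hx, Cantor.cancel_of_to.
Qed.

Section Coordinates.

Variable H : CHilbert.
Variable co : H -> nat -> nat -> C.
Hypothesis Hco : coordinates H co.

Lemma co_opp (x : H) (n j : nat) : co (hopp H x) n j = Copp (co x n j).
Proof.
  rewrite hopp_scal, (co_scal _ _ Hco).
  replace (RtoC (-1)) with (Copp (RtoC 1)); [ring|]. rewrite <- RtoC_opp. f_equal.
Qed.

Lemma co_zero (n j : nat) : co (hzero H) n j = RtoC 0.
Proof. rewrite <- (hscal_zero_l H (hzero H)), (co_scal _ _ Hco). ring. Qed.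

Lemma co_eq0 (x : H) : (forall n j, co x n j = RtoC 0) -> x = hzero H.
Proof.
  intros E. apply nsq_eq0, Rle_antisym; [|apply nsq_ge0].
  apply (co_ge _ _ Hco). intros N. right.
  apply rsum_0; intros; apply rsum_0; intros. rewrite E, Cmod_0. ring.
Qed.

Lemma co_inj (x y : H) : (forall n j, co x n j = co y n j) -> x = y.
Proof.
  intros E. apply hsub_zero, co_eq0. intros n j.
  rewrite (co_add _ _ Hco), co_opp, E. ring.
Qed.

Lemma co_le_hnorm (x : H) (n j : nat) : Cmod (co x n j) <= hnorm H x.
Proof.
  apply sq_le_inv; [apply hnorm_ge0|]. rewrite hnorm_sq.
  apply Rle_trans with (2 := co_le _ _ Hco x (S (n + j))).
  apply Rle_trans with (rsum (S (n + j)) (fun j => Cmod (co x n j) ^ 2)).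
  - apply (rsum_term_le _ _ (fun j => Cmod (co x n j) ^ 2)); [intros; apply pow2_ge_0|lia].
  - apply (rsum_term_le _ _ (fun n => rsum (S _) (fun j => Cmod (co x n j) ^ 2))); [|lia].
    intros; apply rsum_ge0; intros; apply pow2_ge_0.
Qed.

Lemma hnorm_le_sqsum (x y : H) (M : R) : 0 <= M ->
  (forall N, sqsum N (co y) <= M ^ 2 * sqsum N (co x)) -> hnorm H y <= M * hnorm H x.
Proof.
  intros HM E. pose proof (hnorm_ge0 H x).
  apply sq_le_inv; [now apply Rmult_le_pos|]. rewrite Rpow_mult_distr, !hnorm_sq.
  apply (co_ge _ _ Hco). intros N. apply Rle_trans with (1 := E N).
  apply Rmult_le_compat_l; [apply pow2_ge_0|apply (co_le _ _ Hco)].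
Qed.

(** The bound is asked on each truncation separately, which suits maps whose entries depend only on
    earlier entries of the same row. Linearity is phrased through a pointwise equal [h] because the
    coordinates of a sum are only pointwise the sum of the coordinates. *)
Lemma operator_of_coordinates (A : (nat -> nat -> C) -> nat -> nat -> C) (M : R) :
  (forall a f g h, (forall n j, h n j = Cplus (f n j) (Cmult a (g n j))) ->
     forall n j, A h n j = Cplus (A f n j) (Cmult a (A g n j))) ->
  0 <= M -> (forall f N, sqsum N (A f) <= M ^ 2 * sqsum N f) ->
  exists T, bounded_op H T /\ forall x n j, co (T x) n j = A (co x) n j.
Proof.
  intros Alin HM Abd.
  assert (E : forall x, exists y, forall n j, co y n j = A (co x) n j).
  { intros x. apply (co_surj _ _ Hco _ (M ^ 2 * nsq H x)). intros N.
    apply Rle_trans with (1 := Abd _ N).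
    apply Rmult_le_compat_l; [apply pow2_ge_0|apply (co_le _ _ Hco)]. }
  set (T := fun x => proj1_sig (constructive_indefinite_description _ (E x))).
  assert (HT : forall x n j, co (T x) n j = A (co x) n j)
    by exact (fun x => proj2_sig (constructive_indefinite_description _ (E x))).
  clearbody T. exists T. split; [|exact HT]. repeat split.
  - intros x y. apply co_inj. intros n j. rewrite (co_add _ _ Hco), !HT.
    rewrite (Alin (RtoC 1) (co x) (co y)); [ring|].
    intros. rewrite (co_add _ _ Hco). ring.
  - intros a x. apply co_inj. intros n j. rewrite (co_scal _ _ Hco), !HT.
    (* Linearity applied to [0 = 0 + (-1) * 0]. *)
    assert (Z : A (fun _ _ => RtoC 0) n j = RtoC 0).
    { rewrite (Alin (Copp (RtoC 1)) (fun _ _ => RtoC 0) (fun _ _ => RtoC 0)) by (intros; ring).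
      ring. }
    rewrite (Alin a (fun _ _ => RtoC 0) (co x)); [rewrite Z; ring|].
    intros. rewrite (co_scal _ _ Hco). ring.
  - exists M. intros x. apply hnorm_le_sqsum; [exact HM|]. intros N.
    apply Rle_trans with (2 := Abd (co x) N). right.
    apply rsum_ext; intros; apply rsum_ext; intros. now rewrite HT.
Qed.

End Coordinates.

(** * Weighted shifts and their resolvents *)

Definition shift (W : nat -> nat -> R) (f : nat -> nat -> C) (n j : nat) : C :=
  match j with
  | O => RtoC 0
  | S i => Cmult (RtoC (W n i)) (f n i)
  end.

(** Forward substitution in [(l - T) y = f], that is [l y_0 = f_0] and
    [l y_(i+1) - w_i y_i = f_(i+1)]. *)
Fixpoint solve_row (w : nat -> R) (l : C) (f : nat -> C) (j : nat) : C :=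
  match j with
  | O => Cdiv (f O) l
  | S i => Cdiv (Cplus (f (S i)) (Cmult (RtoC (w i)) (solve_row w l f i))) l
  end.

Definition solve (W : nat -> nat -> R) (l : C) (f : nat -> nat -> C) (n j : nat) : C :=
  solve_row (W n) l (f n) j.

Lemma shift_row_le (w : nat -> R) (a b : nat -> R) (N : nat) :
  (forall i, 0 <= w i <= 1) -> b O = 0 -> (forall i, b (S i) = w i * a i) ->
  rsum (S N) (fun j => b j ^ 2) <= rsum N (fun j => a j ^ 2).
Proof.
  intros Hw B0 BS. induction N as [|N IH].
  - simpl. rewrite B0. lra.
  - change (rsum (S (S N)) ?f) with (rsum (S N) f + f (S N)). simpl rsum at 2. cbv beta.
    rewrite BS. pose proof (Hw N) as Hn.
    assert ((w N * a N) ^ 2 <= a N ^ 2); [|simpl in *; lra].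
    rewrite Rpow_mult_distr. pose proof (pow2_ge_0 (a N)).
    assert (w N ^ 2 <= 1) by nra. nra.
Qed.

Lemma shift_sqsum (W : nat -> nat -> R) (f : nat -> nat -> C) (N : nat) :
  (forall n i, 0 <= W n i <= 1) -> sqsum N (shift W f) <= 1 ^ 2 * sqsum N f.
Proof.
  intros HW. rewrite pow1, Rmult_1_l. apply rsum_le. intros n _.
  eapply Rle_trans; [apply (rsum_incr N (S N)); [intros; apply pow2_ge_0|lia]|].
  apply (shift_row_le (W n)); [apply HW| |].
  - simpl. apply Cmod_0.
  - intros i. simpl. rewrite Cmod_mult, Cmod_R, Rabs_right; [reflexivity|].
    apply Rle_ge, HW.
Qed.

(* The potential [p j = 2 G^(2 (J - j))] satisfies [p i >= 1 + 2 (w i / s)^2 p (i + 1)],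
   which is what lets [(p m - 1) b_m^2] be carried along the induction. *)
Lemma solve_row_upper (w a b : nat -> R) (s G : R) (J N : nat) :
  0 < s -> 1 <= G -> 2 / s <= G -> (forall i, 0 <= w i <= 1) ->
  (forall i, (J <= i)%nat -> w i <= s / 2) ->
  (forall i, 0 <= a i) -> (forall i, 0 <= b i) ->
  b O <= a O / s -> (forall i, b (S i) <= (a (S i) + w i * b i) / s) ->
  rsum N (fun j => b j ^ 2) <= (2 / s * G ^ J) ^ 2 * rsum N (fun j => a j ^ 2).
Proof.
  intros Hs HG HGs Hw HJ Ha Hb B0 BS.
  set (p := fun j => 2 * (G ^ 2) ^ (J - j)).
  assert (HG2 : 1 <= G ^ 2) by nra.
  assert (Hp2 : forall j, 2 <= p j).
  { intros j. unfold p. pose proof (pow_R1_Rle (G ^ 2) (J - j) HG2). lra. }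
  assert (HpJ : forall j, p j <= 2 * (G ^ J) ^ 2).
  { intros j. unfold p.
    apply Rmult_le_compat_l; [lra|].
    rewrite <- (pow_mult G J 2), (Nat.mul_comm J 2), pow_mult.
    apply Rle_pow; [exact HG2|lia]. }
  assert (HpS : forall i, 2 * (w i / s) ^ 2 * p (S i) <= p i - 1).
  { intros i. specialize (Hp2 (S i)). destruct (Hw i) as [W0 W1].
    assert (Hws : 0 <= w i / s) by (apply Rdiv_le_0_compat; assumption).
    (* From [J] on, [p] is constantly 2 and [w i / s <= 1 / 2], which gives exactly [p i - 1 = 1].
       Before [J], [p] drops by the factor [G ^ 2 >= 4 (w i / s) ^ 2], so the left side is at most
       [p i / 2], and [p i >= 2]. *)
    destruct (Nat.le_gt_cases J i) as [Hi|Hi].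
    - specialize (HJ i Hi).
      assert (w i / s <= 1 / 2).
      { apply Rmult_le_reg_r with s; [exact Hs|]. field_simplify; lra. }
      assert (p (S i) = 2) by (unfold p; replace (J - S i)%nat with O by lia; simpl; ring).
      assert (p i = 2) by (unfold p; replace (J - i)%nat with O by lia; simpl; ring).
      nra.
    - assert (E : p i = G ^ 2 * p (S i)).
      { unfold p. replace (J - i)%nat with (S (J - S i)) by lia. simpl. ring. }
      assert (Hwg : 2 * (w i / s) <= G).
      { apply Rle_trans with (2 := HGs). unfold Rdiv.
        pose proof (Rinv_0_lt_compat s Hs). nra. }
      assert (4 * (w i / s) ^ 2 <= G ^ 2) by nra.
      rewrite E. nra. }
  assert (Q : forall N, rsum (S N) (fun j => b j ^ 2) + (p N - 1) * b N ^ 2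
               <= 2 / s ^ 2 * rsum (S N) (fun j => p j * a j ^ 2)).
  { clear N. intros N. induction N as [|N IH].
    - specialize (Hp2 O).
      assert (L : b O ^ 2 <= (a O / s) ^ 2) by (apply pow_incr; split; [apply Hb|exact B0]).
      apply (Rmult_le_compat_l (p O)) in L; [|lra].
      replace (rsum 1 (fun j => b j ^ 2) + (p O - 1) * b O ^ 2) with (p O * b O ^ 2)
        by (simpl; ring).
      replace (2 / s ^ 2 * rsum 1 (fun j => p j * a j ^ 2))
        with (2 * (p O * (a O / s) ^ 2)) by (simpl; field; lra).
      pose proof (Rmult_le_pos (p O) _ ltac:(lra) (pow2_ge_0 (a O / s))). lra.
    - change (rsum (S (S N)) ?f) with (rsum (S N) f + f (S N)). cbv beta.
      specialize (HpS N). specialize (Hp2 (S N)).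
      assert (L : b (S N) ^ 2 <= 2 * (a (S N) / s) ^ 2 + 2 * (w N / s) ^ 2 * b N ^ 2).
      { apply Rle_trans with (((a (S N) + w N * b N) / s) ^ 2).
        - apply pow_incr. split; [apply Hb|apply BS].
        - replace ((a (S N) + w N * b N) / s) with (a (S N) / s + w N / s * b N)
            by (field; lra).
          pose proof (pow2_ge_0 (a (S N) / s - w N / s * b N)). nra. }
      assert (L2 : p (S N) * b (S N) ^ 2
        <= p (S N) * (2 * (a (S N) / s) ^ 2) + (p N - 1) * b N ^ 2).
      { pose proof (pow2_ge_0 (b N)). pose proof (pow2_ge_0 (w N / s)). nra. }
      rewrite Rmult_plus_distr_l.
      replace (2 / s ^ 2 * (p (S N) * a (S N) ^ 2))
        with (p (S N) * (2 * (a (S N) / s) ^ 2)) by (field; lra).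
      lra. }
  destruct N as [|N]; [simpl; lra|].
  specialize (Q N). specialize (Hp2 N). pose proof (pow2_ge_0 (b N)).
  apply Rle_trans with (2 / s ^ 2 * rsum (S N) (fun j => p j * a j ^ 2)); [nra|].
  apply Rle_trans with (2 / s ^ 2 * rsum (S N) (fun j => 2 * (G ^ J) ^ 2 * a j ^ 2)).
  - apply Rmult_le_compat_l.
    + apply Rlt_le, Rdiv_lt_0_compat; [lra|now apply pow_lt].
    + apply rsum_le. intros i _. apply Rmult_le_compat_r; [apply pow2_ge_0|apply HpJ].
  - rewrite rsum_scal. right. field. lra.
Qed.

(** Rows in which [f] vanishes put no condition on [J]: this is how the estimate for a single vector
    comes to depend only on the summands that it meets. *)
Lemma solve_sqsum (W : nat -> nat -> R) (l : C) (f : nat -> nat -> C) (G : R) (J N : nat) :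
  l <> RtoC 0 -> 1 <= G -> 2 / Cmod l <= G -> (forall n i, 0 <= W n i <= 1) ->
  (forall n, (forall j, f n j = RtoC 0) \/
             forall i, (J <= i)%nat -> W n i <= Cmod l / 2) ->
  sqsum N (solve W l f) <= (2 / Cmod l * G ^ J) ^ 2 * sqsum N f.
Proof.
  intros Hl HG HGl HW HJ. unfold sqsum. rewrite <- rsum_scal. apply rsum_le. intros n _.
  destruct (HJ n) as [E|E].
  - rewrite rsum_0.
    + apply Rmult_le_pos; [apply pow2_ge_0|]. apply rsum_ge0. intros; apply pow2_ge_0.
    + intros j _. replace (solve W l f n j) with (RtoC 0).
      * rewrite Cmod_0. ring.
      * symmetry. unfold solve. induction j as [|j IH]; simpl; rewrite E; [|rewrite IH];
          field; exact Hl.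
  - apply (solve_row_upper (W n)); try assumption; try apply HW;
      try (intros; apply Cmod_ge_0).
    + now apply Cmod_gt_0.
    + right. unfold solve; simpl. now rewrite Cmod_div.
    + intros i. unfold solve at 1; simpl. rewrite Cmod_div by exact Hl.
      unfold Rdiv. apply Rmult_le_compat_r.
      { apply Rlt_le, Rinv_0_lt_compat. now apply Cmod_gt_0. }
      eapply Rle_trans; [apply Cmod_triangle|]. rewrite Cmod_mult, Cmod_R, Rabs_right.
      * apply Rle_refl.
      * apply Rle_ge, HW.
Qed.

(** * The lacunary weights and the operator norm *)

Definition weight (r : R) (i : nat) : R :=
  if Rlt_dec 0 r then exp (- exp (INR i / r)) else 0.

Lemma weight_bounds (r : R) (i : nat) : 0 <= weight r i <= 1.
Proof.
  unfold weight. destruct (Rlt_dec 0 r); [|lra].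
  split; [apply Rlt_le, exp_pos|]. rewrite <- exp_0. apply Rlt_le, exp_increasing.
  pose proof (exp_pos (INR i / r)). lra.
Qed.

Lemma exp_le (x y : R) : x <= y -> exp x <= exp y.
Proof. intros [L| ->]; [left; now apply exp_increasing|right; reflexivity]. Qed.

Lemma ln_ge0 (u : R) : 1 <= u -> 0 <= ln u.
Proof. intros Hu. rewrite <- ln_1. apply ln_le; lra. Qed.

(** If [i > rho * ln u], then [exp (i / r) >= u] for every positive [r <= rho]. One [J] thus serves
    all summands, which is the source of the uniformity in [n]. *)
Lemma weight_small (rho u : R) : 0 <= rho -> 1 <= u ->
  exists J, INR J <= rho * ln u + 1 /\
    forall r i, r <= rho -> (J <= i)%nat -> weight r i <= exp (- u).
Proof.
  intros Hrho Hu. pose proof (ln_ge0 u Hu) as L.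
  destruct (nfloor_ex (rho * ln u)) as [J [J1 J2]]; [now apply Rmult_le_pos|].
  exists (S J). rewrite S_INR. split; [lra|]. intros r i Hr Hi.
  unfold weight. destruct (Rlt_dec 0 r) as [Hr0|Hr0]; [|apply Rlt_le, exp_pos].
  apply exp_le, Ropp_le_contravar.
  rewrite <- (exp_ln u) at 1 by lra. apply exp_le.
  apply Rmult_le_reg_r with r; [exact Hr0|].
  replace (INR i / r * r) with (INR i) by (field; lra).
  apply le_INR in Hi. rewrite S_INR in Hi. nra.
Qed.

(** Boundedness keeps the least upper bound finite; on an infinite one [real] would return the
    default 0. *)
Lemma bounded_op_opnorm (H : CHilbert) (S : H -> H) (x : H) :
  bounded_op H S -> hnorm H x <= 1 -> hnorm H (S x) <= opnorm H S.
Proof.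
  intros [_ [_ [M HM]]] Hx.
  assert (HM' : forall y, hnorm H y <= 1 -> hnorm H (S y) <= Rabs M).
  { intros y Hy. apply Rle_trans with (1 := HM y).
    pose proof (Rle_abs M). pose proof (Rabs_pos M). pose proof (hnorm_ge0 H y). nra. }
  unfold opnorm.
  destruct (Lub_Rbar_correct (fun r => exists x, hnorm H x <= 1 /\ r = hnorm H (S x)))
    as [U L].
  specialize (U (hnorm H (S x)) (ex_intro _ x (conj Hx eq_refl))).
  specialize (L (Finite (Rabs M))).
  destruct (Lub_Rbar _) as [v| |]; simpl in *; [exact U| |contradiction].
  elim L. intros r [y [Hy ->]]. simpl. auto.
Qed.

Lemma opnorm_le (H : CHilbert) (S : H -> H) (M : R) :
  0 <= M -> (forall x, hnorm H (S x) <= M * hnorm H x) -> opnorm H S <= M.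
Proof.
  intros HM0 HM. unfold opnorm.
  destruct (Lub_Rbar_correct (fun r => exists x, hnorm H x <= 1 /\ r = hnorm H (S x)))
    as [_ L].
  specialize (L (Finite M)).
  destruct (Lub_Rbar _) as [v| |]; simpl in *; [|lra|lra].
  apply L. intros r [y [Hy ->]]. simpl. apply Rle_trans with (1 := HM y).
  pose proof (hnorm_ge0 H y). nra.
Qed.

Lemma solve_row_lead (w : nat -> R) (l : C) (f : nat -> C) (m : nat) :
  l <> RtoC 0 -> (forall i, (i < m)%nat -> f i = RtoC 0) ->
  solve_row w l f m = Cdiv (f m) l.
Proof.
  intros Hl Hf.
  assert (Z : forall i, (i < m)%nat -> solve_row w l f i = RtoC 0).
  { induction i as [|i IH]; intros Hi; simpl; rewrite Hf by exact Hi; [|rewrite IH by lia];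
      field; exact Hl. }
  destruct m as [|m]; [reflexivity|]. simpl. rewrite Z by lia. field. exact Hl.
Qed.

(** * Lower bounds for the resolvent *)

(** The product of [w i / |l|] over [m <= i < m + d], for [w i = exp (- tau i)] and
    [|l| = exp (- t)]: the amplification of entry [m] on its way to position [m + d]. *)
Definition growth (tau : nat -> R) (m : nat) (t : R) (d : nat) : R :=
  exp (INR d * t - rsum d (fun i => tau (m + i)%nat)).

Lemma growth_S (tau : nat -> R) (m : nat) (t : R) (d : nat) :
  growth tau m t (S d) = exp (- tau (m + d)%nat) * exp t * growth tau m t d.
Proof.
  unfold growth. rewrite <- !exp_plus, S_INR. f_equal. simpl rsum. ring.
Qed.

(** Unrolled, [l y_(m+d)] is the sum over [j <= d] of [f (m + j)] times the product of [w i / l]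
    from [m + j] on, of modulus [growth d / growth j]. Under the hypothesis each of the [d] terms
    after the leading one is at most [growth d * eps]. *)
Lemma solve_row_lower (w tau : nat -> R) (l : C) (f : nat -> C) (m D : nat) (t eps : R) :
  Cmod l = exp (- t) -> (forall i, w i = exp (- tau i)) ->
  (forall i, (i < m)%nat -> f i = RtoC 0) ->
  (forall d, (d < D)%nat -> Cmod (f (m + S d)%nat) <= growth tau m t (S d) * eps) ->
  forall d, (d <= D)%nat ->
  growth tau m t d * (Cmod (f m) - INR d * eps) <= exp (- t) * Cmod (solve_row w l f (m + d)).
Proof.
  intros Hl Hw Hf Heps.
  assert (Hl0 : l <> RtoC 0).
  { intros E. rewrite E, Cmod_0 in Hl. pose proof (exp_pos (- t)). lra. }
  assert (HC : forall z, exp (- t) * Cmod (Cdiv z l) = Cmod z).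
  { intros z. rewrite Cmod_div, Hl by exact Hl0. pose proof (exp_pos (- t)). field. lra. }
  induction d as [|d IH]; intros Hd.
  - rewrite Nat.add_0_r, solve_row_lead, HC by assumption.
    unfold growth. simpl. rewrite !Rmult_0_l, Rminus_0_r, exp_0. lra.
  - specialize (IH ltac:(lia)). specialize (Heps d ltac:(lia)).
    rewrite Nat.add_succ_r in *. simpl solve_row. rewrite HC.
    set (y := solve_row w l f (m + d)) in *. set (z := f (S (m + d))) in *.
    assert (L : Cmod (Cmult (RtoC (w (m + d)%nat)) y) - Cmod z
                <= Cmod (Cplus z (Cmult (RtoC (w (m + d)%nat)) y))).
    { pose proof (Cmod_triangle (Cplus z (Cmult (RtoC (w (m + d)%nat)) y)) (Copp z)) as L.
      rewrite Cmod_opp in L.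
      replace (Cplus (Cplus z (Cmult (RtoC (w (m + d)%nat)) y)) (Copp z))
        with (Cmult (RtoC (w (m + d)%nat)) y) in L by ring. lra. }
    apply Rle_trans with (2 := L).
    rewrite Cmod_mult, Cmod_R, Hw, Rabs_right by (apply Rle_ge, Rlt_le, exp_pos).
    rewrite growth_S, S_INR in *. set (g := growth tau m t d) in *.
    pose proof (exp_pos (- tau (m + d)%nat)) as P1. pose proof (exp_pos t) as P2.
    assert (E : exp (- t) * exp t = 1) by (rewrite <- exp_plus, Rplus_opp_l; apply exp_0).
    set (W := exp (- tau (m + d)%nat)) in *. set (et := exp t) in *.
    apply Rmult_le_compat_l with (r := W * et) in IH;
      [|apply Rlt_le, Rmult_lt_0_compat; assumption].
    replace (W * et * (exp (- t) * Cmod y)) with (W * Cmod y * (exp (- t) * et)) in IH by ring.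
    rewrite E in IH. lra.
Qed.

Lemma rsum_tail_le (f : nat -> R) (m d : nat) :
  (forall i, 0 <= f i) -> rsum d (fun i => f (m + i)%nat) <= rsum (m + d) f.
Proof.
  intros Hf. induction d as [|d IH]; [now apply rsum_ge0|].
  rewrite Nat.add_succ_r. simpl. lra.
Qed.

Lemma exp_1_ge2 : 2 <= exp 1.
Proof. pose proof (exp_ineq1 1). lra. Qed.

(** The ratio [exp (1 / r)] is at least 2 because [r <= 1], so a geometric sum stays below its next
    term. All exponents together then cost a single [t] in [growth_ge]. *)
Lemma rsum_exp_le (r : R) (j : nat) : 0 < r <= 1 ->
  rsum j (fun i => exp (INR i / r)) <= exp (INR j / r).
Proof.
  intros Hr. induction j as [|j IH].
  - simpl. apply Rlt_le, exp_pos.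
  - rewrite S_INR. simpl rsum.
    replace ((INR j + 1) / r) with (INR j / r + 1 / r) by (field; lra). rewrite exp_plus.
    assert (2 <= exp (1 / r)).
    { apply Rle_trans with (1 := exp_1_ge2). apply exp_le.
      apply Rmult_le_reg_r with r; [lra|]. field_simplify; lra. }
    pose proof (exp_pos (INR j / r)). nra.
Qed.

Lemma growth_ge (r t : R) (m d : nat) : 0 < r <= 1 -> exp (INR (m + d) / r) <= t ->
  exp (INR d * t - t) <= growth (fun i => exp (INR i / r)) m t d.
Proof.
  intros Hr Ht. apply exp_le.
  pose proof (rsum_tail_le (fun i => exp (INR i / r)) m d
    ltac:(intros; apply Rlt_le, exp_pos)).
  pose proof (rsum_exp_le r (m + d) Hr). lra.
Qed.

Lemma weight_pos (r : R) (i : nat) : 0 < r -> weight r i = exp (- exp (INR i / r)).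
Proof. intros Hr. unfold weight. destruct (Rlt_dec 0 r); [reflexivity|lra]. Qed.

Lemma INR_div_le (r : R) (i j : nat) : 0 < r -> (i <= j)%nat -> INR i / r <= INR j / r.
Proof.
  intros Hr Hij. apply le_INR in Hij. apply Rmult_le_compat_r; [|exact Hij].
  apply Rlt_le, Rinv_0_lt_compat, Hr.
Qed.

(* At [|l| = weight r k] every factor [weight r i / |l|] with [i <= k] is at least 1, so the
   leading entry [f m] cannot be cancelled by the later ones. *)
Lemma solve_row_resonant (r X : R) (f : nat -> C) (m : nat) : 0 < r <= 1 ->
  (forall i, (i < m)%nat -> f i = RtoC 0) -> f m <> RtoC 0 -> (forall i, Cmod (f i) <= X) ->
  exists K, forall k l, K <= INR k -> Cmod l = exp (- exp (INR k / r)) ->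
    Cmod (f m) / 2 * exp ((INR k - INR m) * exp (INR k / r))
    <= Cmod (solve_row (weight r) l f k).
Proof.
  intros Hr Hf Hm HX. apply Cmod_gt_0 in Hm. set (a := Cmod (f m)) in *.
  set (tau := fun i => exp (INR i / r)).
  assert (HX0 : 0 <= X) by (apply Rle_trans with (2 := HX m); apply Cmod_ge_0).
  assert (HA : 0 <= 8 * X * exp (tau m) / a).
  { apply Rdiv_le_0_compat; [|exact Hm]. pose proof (exp_pos (tau m)). nra. }
  (* The first two terms put [k] beyond [m]. The last gives [8 X exp (tau m) <= a k], which with
     [k ^ 2 / 4 <= exp t] yields [k * eps <= a / 2] below. *)
  exists (INR m + 1 + 8 * X * exp (tau m) / a). intros k l HK Hl.
  pose proof (pos_INR m) as Pm.
  assert (Hmk : (m <= k)%nat) by (apply INR_le; lra).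
  set (t := exp (INR k / r)) in *.
  assert (Htk : INR k <= t).
  { unfold t. apply Rle_trans with (INR k / r).
    - apply Rmult_le_reg_r with r; [lra|]. field_simplify; [|lra]. nra.
    - pose proof (exp_ineq1_le (INR k / r)). lra. }
  (* Up to position [k], [growth] never falls below its first value [exp (t - tau m)], so this [eps]
     absorbs every later entry; it decays like [exp (- t)] while only [k - m <= t] entries
     compete. *)
  set (eps := X * exp (tau m - t)).
  assert (Hg : forall d, (d < k - m)%nat -> exp (t - tau m) <= growth tau m t (S d)).
  { induction d as [|d IH]; intros Hd.
    - apply exp_le. simpl. rewrite Nat.add_0_r. lra.
    - apply Rle_trans with (1 := IH ltac:(lia)). rewrite (growth_S _ _ _ (S d)).
      rewrite <- exp_plus.
      assert (1 <= exp (- tau (m + S d)%nat + t)).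
      { rewrite <- exp_0 at 1. apply exp_le. unfold t, tau.
        assert (exp (INR (m + S d) / r) <= exp (INR k / r)); [|lra].
        apply exp_le, INR_div_le; [lra|lia]. }
      assert (0 < growth tau m t (S d)) by apply exp_pos. nra. }
  pose proof (solve_row_lower (weight r) tau l f m (k - m) t eps Hl
    (fun i => weight_pos r i (proj1 Hr)) Hf) as L.
  specialize (fun Heps => L Heps (k - m)%nat (le_n _)).
  replace (m + (k - m))%nat with k in L by lia.
  assert (Heps0 : 0 <= eps) by (apply Rmult_le_pos; [exact HX0|apply Rlt_le, exp_pos]).
  assert (Heps : INR (k - m) * eps <= a / 2).
  { assert (Hsq : INR k ^ 2 / 4 <= exp t).
    { replace t with (t / 2 + t / 2) by field. rewrite exp_plus.
      pose proof (exp_ineq1_le (t / 2)). pose proof (pos_INR k). nra. }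
    assert (Hak : 8 * X * exp (tau m) <= a * INR k).
    { apply Rmult_le_reg_r with (/ a); [now apply Rinv_0_lt_compat|].
      replace (a * INR k * / a) with (INR k) by (field; lra).
      unfold Rdiv in HK. lra. }
    apply Rle_trans with (INR k * eps).
    - apply Rmult_le_compat_r; [exact Heps0|]. apply le_INR; lia.
    - unfold eps, Rminus. rewrite exp_plus, exp_Ropp.
      pose proof (exp_pos t). apply Rmult_le_reg_r with (exp t); [assumption|].
      replace (INR k * (X * (exp (tau m) * / exp t)) * exp t)
        with (INR k * (X * exp (tau m))) by (field; lra).
      pose proof (pos_INR k). nra. }
  assert (L0 : growth tau m t (k - m) * (a - INR (k - m) * eps)
               <= exp (- t) * Cmod (solve_row (weight r) l f k)).
  { apply L. intros d Hd. apply Rle_trans with (1 := HX _).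
    apply Rle_trans with (exp (t - tau m) * eps).
    - unfold eps. rewrite <- (Rmult_1_r X) at 1. rewrite <- exp_0 at 1.
      replace 0 with ((t - tau m) + (tau m - t)) by ring. rewrite exp_plus. lra.
    - apply Rmult_le_compat_r; [exact Heps0|]. now apply Hg. }
  pose proof (growth_ge r t m (k - m) Hr) as G.
  replace (m + (k - m))%nat with k in G by lia. specialize (G (Rle_refl _)).
  fold tau in G. rewrite minus_INR in G by exact Hmk.
  apply Rmult_le_reg_l with (exp (- t)); [apply exp_pos|].
  apply Rle_trans with (2 := L0).
  replace (exp (- t) * (a / 2 * exp ((INR k - INR m) * t)))
    with (exp ((INR k - INR m) * t - t) * (a / 2))
    by (unfold Rminus at 1; rewrite exp_plus; ring).
  apply Rmult_le_compat; [apply Rlt_le, exp_pos|lra|exact G|lra].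
Qed.

(** Position [k], the integer part of [ln t], carries [exp (k t - t)]; the remaining division by [l]
    contributes [exp t] and makes up for the rounding of [ln t]. *)
Lemma solve_row_unit (l : C) (f : nat -> C) (t : R) : 1 <= t -> Cmod l = exp (- t) ->
  f O = RtoC 1 -> (forall i, f (S i) = RtoC 0) ->
  exists k, exp (t * ln t - t) <= Cmod (solve_row (weight 1) l f k).
Proof.
  intros Ht Hl F0 FS.
  pose proof (ln_ge0 t Ht) as Lt.
  destruct (nfloor_ex (ln t) Lt) as [k [K1 K2]]. exists k.
  pose proof (solve_row_lower (weight 1) (fun i => exp (INR i / 1)) l f 0 k t 0 Hl
    (fun i => weight_pos 1 i Rlt_0_1)) as L.
  specialize (L ltac:(intros; lia)).
  assert (L0 : growth (fun i => exp (INR i / 1)) 0 t k * (Cmod (f O) - INR k * 0)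
    <= exp (- t) * Cmod (solve_row (weight 1) l f k)).
  { apply (L ltac:(intros d _; simpl; rewrite FS, Cmod_0; lra) k (le_n _)). }
  clear L. rewrite F0, Cmod_1, Rmult_0_r, Rminus_0_r, Rmult_1_r in L0.
  pose proof (growth_ge 1 t 0 k ltac:(lra)) as G. simpl Nat.add in G.
  assert (Hk : exp (INR k / 1) <= t).
  { rewrite <- (exp_ln t) by lra. apply exp_le. lra. }
  specialize (G Hk).
  apply Rmult_le_reg_l with (exp (- t)); [apply exp_pos|].
  apply Rle_trans with (2 := L0). apply Rle_trans with (2 := G).
  rewrite <- exp_plus. apply exp_le. nra.
Qed.

(** The left side bounds the exponent of [(2 / |l|) ^ (J + 1)], where [2 / |l| = exp (t + ln 2)] and
    [J <= rho ln (t + ln 2) + 1]. The 7 arises from [rho ln t + rho t + rho + 2 t + 2], at most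
    [t + t + t + 2 t + 2 t]. *)
Lemma entropy_bound (rho t : R) : 0 <= rho <= 1 -> 1 <= t ->
  (rho * ln (t + ln 2) + 2) * (t + ln 2) <= rho * (t * ln t) + 7 * t.
Proof.
  intros Hr Ht. pose proof (ln_ge0 t Ht) as Lt.
  assert (L2 : 0 < ln 2 <= 1).
  { split; [rewrite <- ln_1; apply ln_increasing; lra|].
    rewrite <- (ln_exp 1). apply ln_le; [lra|apply exp_1_ge2]. }
  assert (Lu : ln (t + ln 2) <= ln t + 1).
  { apply Rle_trans with (ln (t * 2)); [apply ln_le; lra|]. rewrite ln_mult; lra. }
  assert (Ltt : ln t <= t).
  { rewrite <- (ln_exp t) at 2. apply ln_le; [lra|]. pose proof (exp_ineq1_le t). lra. }
  assert (Lu0 : 0 <= ln (t + ln 2)) by (apply ln_ge0; lra).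
  apply Rle_trans with ((rho * (ln t + 1) + 2) * (t + 1)).
  - apply Rmult_le_compat; try lra; nra.
  - nra.
Qed.

(** * Uniqueness of the upper limit and approximation from the left *)

Lemma is_limsup0_unique (f : C -> R) (L L' : Rbar) :
  is_limsup0 f L -> is_limsup0 f L' -> L = L'.
Proof.
  assert (W : forall L L', is_limsup0 f L -> is_limsup0 f L' -> ~ Rbar_lt L L').
  { clear. intros L L' [H1 _] [_ H2] Hlt.
    assert (M : exists M : R, Rbar_lt L M /\ Rbar_lt M L').
    { destruct L as [x| |], L' as [y| |]; simpl in Hlt; try contradiction.
      - exists ((x + y) / 2). simpl. lra.
      - exists (x + 1). simpl. split; [lra|exact I].
      - exists (y - 1). simpl. split; [exact I|lra].
      - exists 0. simpl. tauto. }
    destruct M as [M [M1 M2]]. destruct (H1 M M1) as [d [Hd Hd']].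
    destruct (H2 M M2 d Hd) as [l [Hl Hl']]. specialize (Hd' l Hl). lra. }
  intros HL HL'. destruct (Rbar_total_order L L') as [[Hlt|E]|Hgt]; [|exact E|].
  - now elim (W L L').
  - now elim (W L' L).
Qed.

(** An enumeration that reaches every rational from -1 on; negative ones are needed to separate the
    point 0 of sigma from its left. *)
Definition grid (c : nat) : R :=
  INR (fst (Cantor.of_nat c)) / INR (snd (Cantor.of_nat c)) - 1.

Lemma grid_dense (a b : R) : -1 <= a < b -> exists c, a < grid c < b.
Proof.
  intros Hab. destruct (archimed_cor1 (b - a)) as [k [K1 K2]]; [lra|].
  apply lt_0_INR in K2.
  destruct (nfloor_ex ((a + 1) * INR k)) as [i [I1 I2]]; [apply Rmult_le_pos; lra|].
  exists (Cantor.to_nat (S i, k)). unfold grid. rewrite Cantor.cancel_of_to.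
  cbn [fst snd]. rewrite S_INR.
  assert (E : INR k * / INR k = 1) by (field; lra).
  pose proof (Rinv_0_lt_compat _ K2) as P. unfold Rdiv. split; nra.
Qed.

(** Ordinary density would not do: only the [rho n <= s] may approximate [s], so a point with a gap
    of sigma on its left must itself occur. Such points are countably many, as their gaps contain
    distinct rationals. *)
Lemma countable_left_dense (sigma : R -> Prop) :
  (forall r, sigma r -> 0 <= r) -> sigma 1 ->
  exists rho : nat -> R, rho O = 1 /\ (forall n, sigma (rho n)) /\
    forall s m, sigma s -> m < s -> exists n, m < rho n <= s.
Proof.
  intros H0 H1.
  (* Given p < s, either some point of sigma lies in ]p, s[ and one can be picked below a rational
     q < s, or s is the least point of sigma above p. *)
  set (good := fun p q r => sigma r /\ p < r /\
                 (r < q \/ forall y, sigma y -> p < y -> r <= y)).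
  assert (E : forall p q, exists r, sigma r /\ ((exists r', good p q r') -> good p q r)).
  { intros p q. destruct (classic (exists r', good p q r')) as [[r Hr]|Hno].
    - exists r. split; [apply Hr|auto].
    - exists 1. split; [exact H1|contradiction]. }
  set (pick := fun p q => proj1_sig (constructive_indefinite_description _ (E p q))).
  assert (Hpick : forall p q, sigma (pick p q) /\
            ((exists r', good p q r') -> good p q (pick p q)))
    by exact (fun p q => proj2_sig (constructive_indefinite_description _ (E p q))).
  clearbody pick.
  exists (fun n => match n with
    | O => 1
    | S c => pick (grid (fst (Cantor.of_nat c))) (grid (snd (Cantor.of_nat c)))
    end).
  split; [reflexivity|]. split; [intros [|c]; [exact H1|exact (proj1 (Hpick _ _))]|].
  intros s m Hs Hm. pose proof (H0 s Hs) as Hs0.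
  destruct (grid_dense (Rmax m (-1)) s) as [i Hi].
  { split; [apply Rmax_r|]. apply Rmax_lub_lt; lra. }
  pose proof (Rmax_l m (-1)). pose proof (Rmax_r m (-1)). set (p := grid i) in *.
  assert (Hj : exists j, grid j < s /\ exists r, good p (grid j) r).
  { destruct (classic (exists a, sigma a /\ p < a < s)) as [[a [Ha Hpa]]|Hno].
    - destruct (grid_dense a s) as [j Hj]; [lra|]. exists j. split; [lra|].
      exists a. repeat split; [exact Ha|lra|left; lra].
    - destruct (grid_dense p s) as [j Hj]; [lra|]. exists j. split; [lra|].
      exists s. repeat split; [exact Hs|lra|right].
      intros y Hy Hpy. apply Rnot_lt_le. intros Hys. apply Hno. now exists y. }
  destruct Hj as [j [Hj Hex]]. exists (S (Cantor.to_nat (i, j))).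
  rewrite Cantor.cancel_of_to. cbn [fst snd]. fold p.
  destruct (proj2 (Hpick p (grid j)) Hex) as [_ [G1 G2]]. split; [lra|].
  destruct G2 as [G2|G2]; [lra|]. apply G2; [exact Hs|lra].
Qed.

Lemma first_nonzero (f : nat -> C) : (exists j, f j <> RtoC 0) ->
  exists m, f m <> RtoC 0 /\ forall i, (i < m)%nat -> f i = RtoC 0.
Proof.
  intros [j Hj].
  assert (W : forall n, (exists i, (i < n)%nat /\ f i <> RtoC 0) ->
     exists m, f m <> RtoC 0 /\ forall i, (i < m)%nat -> f i = RtoC 0).
  { induction n as [|n IH]; intros [i [Hi Hfi]]; [lia|].
    destruct (classic (exists i, (i < n)%nat /\ f i <> RtoC 0)) as [E|E]; [now apply IH|].
    exists i. split; [exact Hfi|]. intros k Hk. apply NNPP. intros Hfk.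
    apply E. exists k. split; [lia|exact Hfk]. }
  apply (W (S j)). exists j. split; [lia|exact Hj].
Qed.

Lemma ln_ge_of_exp_le (x y : R) : exp x <= y -> x <= ln y.
Proof. intros L. rewrite <- (ln_exp x). apply ln_le; [apply exp_pos|exact L]. Qed.

Lemma ln_le_of_le_exp (x y : R) : 0 < y -> y <= exp x -> ln y <= x.
Proof. intros P L. rewrite <- (ln_exp x). now apply ln_le. Qed.

Lemma Rdiv_lt_of (a b c : R) : 0 < b -> a < c * b -> a / b < c.
Proof.
  intros Hb L. apply Rmult_lt_reg_r with b; [exact Hb|].
  unfold Rdiv. rewrite Rmult_assoc, Rinv_l by lra. lra.
Qed.

Lemma Rlt_div_of (a b c : R) : 0 < b -> c * b < a -> c < a / b.
Proof.
  intros Hb L. apply Rmult_lt_reg_r with b; [exact Hb|].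
  unfold Rdiv. rewrite Rmult_assoc, Rinv_l by lra. lra.
Qed.

(** * The power set of a direct sum of shifts *)

Section WeightedShift.

Variable H : CHilbert.
Variable co : H -> nat -> nat -> C.
Hypothesis Hco : coordinates H co.
Variable rho : nat -> R.
Hypothesis Hrho : forall n, 0 <= rho n <= 1.
Hypothesis Hrho0 : rho O = 1.

Let W (n : nat) : nat -> R := weight (rho n).

Variable T : H -> H.
Hypothesis HT : bounded_op H T.
Hypothesis coT : forall x n j, co (T x) n j = shift W (co x) n j.

Lemma co_shift_op (l : C) (x : H) (n j : nat) :
  co (shift_op H T l x) n j = Cminus (Cmult l (co x n j)) (shift W (co x) n j).
Proof.
  unfold shift_op. rewrite (co_add _ _ Hco), (co_scal _ _ Hco), (co_opp H co Hco), coT.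
  reflexivity.
Qed.

Lemma resolvent_exists (l : C) : l <> RtoC 0 -> exists S,
  is_resolvent H T l S /\ forall x n j, co (S x) n j = solve W l (co x) n j.
Proof.
  intros Hl. pose proof (proj1 (Cmod_gt_0 l) Hl) as Hs.
  (* The maximum with 1 covers large [|l|]; [exp u] then plays the role of [G]. *)
  set (u := Rmax 1 (ln (2 / Cmod l))).
  destruct (weight_small 1 u Rle_0_1 (Rmax_l _ _)) as [J [_ HJ]].
  assert (Hu : 2 / Cmod l <= exp u).
  { rewrite <- (exp_ln (2 / Cmod l)) at 1 by (apply Rdiv_lt_0_compat; lra).
    apply exp_le, Rmax_r. }
  assert (Hu1 : 1 <= exp u).
  { rewrite <- exp_0 at 1. apply exp_le. pose proof (Rmax_l 1 (ln (2 / Cmod l))).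
    fold u in H0. lra. }
  assert (HuJ : exp (- u) <= Cmod l / 2).
  { rewrite exp_Ropp. replace (Cmod l / 2) with (/ (2 / Cmod l)) by (field; lra).
    apply Rinv_le_contravar; [apply Rdiv_lt_0_compat; lra|exact Hu]. }
  destruct (operator_of_coordinates H co Hco (solve W l) (2 / Cmod l * exp u ^ J))
    as [S [S1 S2]].
  - intros a f g h E n j. unfold solve. induction j as [|j IH]; simpl; rewrite E.
    + field. exact Hl.
    + rewrite IH. field. exact Hl.
  - apply Rmult_le_pos; [apply Rdiv_le_0_compat; lra|]. apply pow_le. lra.
  - intros f N. apply solve_sqsum; try assumption.
    + intros; apply weight_bounds.
    + intros n. right. intros i Hi. apply Rle_trans with (2 := HuJ).
      apply HJ; [apply Hrho|exact Hi].
  - exists S. split; [|exact S2]. split; [exact S1|]. split; intros x; apply (co_inj H co Hco).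
    + intros n j. rewrite S2. unfold solve.
      induction j as [|j IH]; simpl; rewrite co_shift_op; [|rewrite IH]; simpl; field; exact Hl.
    + intros n j. rewrite co_shift_op. destruct j as [|j]; simpl; rewrite !S2; unfold solve; simpl;
        field; exact Hl.
Qed.

Lemma resolvent_spec (l : C) : l <> RtoC 0 -> is_resolvent H T l (resolvent H T l).
Proof.
  intros Hl. destruct (resolvent_exists l Hl) as [S [HS _]].
  apply (epsilon_spec (inhabits (fun x : H => x)) (fun S => is_resolvent H T l S)).
  now exists S.
Qed.

Lemma co_resolvent (l : C) (x : H) (n j : nat) : l <> RtoC 0 ->
  co (resolvent H T l x) n j = solve W l (co x) n j.
Proof.
  intros Hl. destruct (resolvent_exists l Hl) as [S [[_ [_ HS]] HSc]]. rewrite <- HSc.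
  destruct (resolvent_spec l Hl) as [_ [HR _]].
  rewrite <- (HS x) at 1. now rewrite HR.
Qed.

Lemma delta_vector : exists x : H, hnorm H x <= 1 /\ co x 0%nat 0%nat = RtoC 1 /\
  forall n j, (n <> 0 \/ j <> 0)%nat -> co x n j = RtoC 0.
Proof.
  set (f := fun n j : nat => match n, j with O, O => RtoC 1 | _, _ => RtoC 0 end).
  assert (Hf : forall N, sqsum N f <= 1).
  { intros N. unfold sqsum.
    assert (E0 : forall M g, (forall j, g (S j) = 0) -> 0 <= g O <= 1 -> rsum M g <= 1).
    { clear. intros M g Hg G0.
      assert (L : rsum M g <= g O); [|lra].
      destruct M as [|M]; [simpl; lra|].
      induction M as [|M IH]; [simpl; lra|].
      change (rsum (S (S M)) g) with (rsum (S M) g + g (S M)). rewrite Hg. lra. }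
    apply E0.
    - intros n. apply rsum_0. intros j _. simpl. rewrite Cmod_0. ring.
    - split; [apply rsum_ge0; intros; apply pow2_ge_0|]. apply E0.
      + intros j. simpl. rewrite Cmod_0. ring.
      + simpl. rewrite Cmod_1. lra. }
  destruct (co_surj _ _ Hco f 1 Hf) as [x Hx]. exists x. split.
  - apply sq_le_inv; [lra|]. rewrite hnorm_sq, pow1. apply (co_ge _ _ Hco).
    intros N. apply Rle_trans with (2 := Hf N). right.
    apply rsum_ext; intros; apply rsum_ext; intros. now rewrite Hx.
  - split; [apply Hx|]. intros n j Hnj. rewrite Hx.
    destruct n as [|n]; [destruct j as [|j]; [lia|reflexivity]|reflexivity].
Qed.

Lemma weighted_shift_quasinilpotent : quasinilpotent H T.
Proof.
  split; [exact HT|]. intros l. split.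
  - intros Hl. apply NNPP. intros Hl0. apply Hl.
    destruct (resolvent_exists l Hl0) as [S [HS _]]. now exists S.
  (* [0 - T] is not onto, since the entry (0, 0) of every value of [T] vanishes. *)
  - intros -> [S [_ [_ HS]]]. destruct delta_vector as [x [_ [Hx _]]].
    rewrite <- (HS x), co_shift_op in Hx. simpl in Hx.
    assert (E : RtoC 0 = RtoC 1) by (rewrite <- Hx; ring).
    injection E. lra.
Qed.

Lemma nonzero_of_exp (l : C) (t : R) : Cmod l = exp (- t) -> l <> RtoC 0.
Proof. intros Hl E. rewrite E, Cmod_0 in Hl. pose proof (exp_pos (- t)). lra. Qed.

(** Used with [r = 1] for the operator norm and with the supremum over the support of [x] for the
    upper half of [k_x]. *)
Lemma resolvent_upper (l : C) (t r : R) (x : H) : 1 <= t -> Cmod l = exp (- t) ->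
  0 <= r <= 1 -> (forall n, (forall j, co x n j = RtoC 0) \/ rho n <= r) ->
  hnorm H (resolvent H T l x) <= exp (r * (t * ln t) + 7 * t) * hnorm H x.
Proof.
  intros Ht Hl Hr Hx. pose proof (nonzero_of_exp l t Hl) as Hl0.
  assert (Hu : exp (t + ln 2) = 2 / Cmod l).
  { rewrite exp_plus, exp_ln, Hl, exp_Ropp by lra. pose proof (exp_pos t). field. lra. }
  assert (L2 : 0 < ln 2) by (rewrite <- ln_1; apply ln_increasing; lra).
  destruct (weight_small r (t + ln 2)) as [J [J1 J2]]; [lra|lra|].
  pose proof (exp_pos (t + ln 2)) as Pu.
  apply Rle_trans with (2 / Cmod l * exp (t + ln 2) ^ J * hnorm H x).
  - apply (hnorm_le_sqsum H co Hco).
    + rewrite <- Hu. apply Rmult_le_pos; [lra|]. apply pow_le; lra.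
    + intros N.
      replace (sqsum N (co (resolvent H T l x))) with (sqsum N (solve W l (co x))).
      * apply solve_sqsum; [exact Hl0| |rewrite Hu; lra|intros; apply weight_bounds|].
        { rewrite <- exp_0 at 1. apply exp_le. lra. }
        intros n. destruct (Hx n) as [E|E]; [now left|right].
        intros i Hi. apply Rle_trans with (1 := J2 _ _ E Hi). right.
        rewrite exp_Ropp, Hu. field. rewrite Hl. pose proof (exp_pos (- t)). lra.
      * apply rsum_ext; intros; apply rsum_ext; intros. now rewrite co_resolvent.
  - apply Rmult_le_compat_r; [apply hnorm_ge0|].
    rewrite <- Hu, <- (Rpower_1 (exp (t + ln 2))) at 1 by exact Pu.
    rewrite <- Rpower_pow by exact Pu. rewrite <- Rpower_plus. unfold Rpower.
    rewrite ln_exp. apply exp_le. apply Rle_trans with (2 := entropy_bound r t Hr Ht).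
    apply Rmult_le_compat_r; lra.
Qed.

Lemma opnorm_upper (l : C) (t : R) : 1 <= t -> Cmod l = exp (- t) ->
  opnorm H (resolvent H T l) <= exp (t * ln t + 7 * t).
Proof.
  intros Ht Hl. apply opnorm_le; [apply Rlt_le, exp_pos|]. intros x.
  rewrite <- (Rmult_1_l (t * ln t)). apply resolvent_upper; try assumption; [lra|].
  intros n. right. apply Hrho.
Qed.

Lemma opnorm_lower (l : C) (t : R) : 1 <= t -> Cmod l = exp (- t) ->
  exp (t * ln t - t) <= opnorm H (resolvent H T l).
Proof.
  intros Ht Hl. pose proof (nonzero_of_exp l t Hl) as Hl0.
  destruct delta_vector as [x [Hx [X0 XS]]].
  destruct (solve_row_unit l (co x 0%nat) t Ht Hl X0) as [k Hk]; [intros; apply XS; lia|].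
  apply Rle_trans with (1 := Hk).
  apply Rle_trans with (2 := bounded_op_opnorm H _ x (proj1 (resolvent_spec l Hl0)) Hx).
  apply Rle_trans with (2 := co_le_hnorm H co Hco _ 0%nat k).
  rewrite co_resolvent by exact Hl0. unfold solve, W. rewrite Hrho0. apply Rle_refl.
Qed.

(** A crude bound valid at every nonzero [l]: it makes the norm positive, so that its [ln] is
    meaningful, and at least 1 for small [l], which settles negative thresholds. *)
Lemma resolvent_lead (l : C) (x : H) (n m : nat) : l <> RtoC 0 ->
  (forall i, (i < m)%nat -> co x n i = RtoC 0) ->
  Cmod (co x n m) / Cmod l <= hnorm H (resolvent H T l x).
Proof.
  intros Hl Hx. apply Rle_trans with (2 := co_le_hnorm H co Hco _ n m).
  rewrite co_resolvent by exact Hl. unfold solve.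
  rewrite solve_row_lead by assumption. rewrite Cmod_div by exact Hl. apply Rle_refl.
Qed.

Definition support_sup (x : H) (r : R) : Prop :=
  is_lub (fun y => exists n, y = rho n /\ exists j, co x n j <> RtoC 0) r.

Lemma ln_opnorm_bounds (l : C) (t : R) : exp 2 <= t -> Cmod l = exp (- t) ->
  2 <= ln t /\ 1 <= t /\
  0 < t * ln t - t <= ln (opnorm H (resolvent H T l)) /\
  ln (opnorm H (resolvent H T l)) <= t * ln t + 7 * t.
Proof.
  intros Ht Hl. pose proof (ln_ge_of_exp_le _ _ Ht) as Lt.
  assert (Ht1 : 1 <= t) by (pose proof (exp_ineq1_le 2); lra).
  pose proof (opnorm_lower l t Ht1 Hl) as L. pose proof (opnorm_upper l t Ht1 Hl) as U.
  repeat split; try assumption; try nra.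
  - now apply ln_ge_of_exp_le.
  - apply ln_le_of_le_exp; [|exact U]. apply Rlt_le_trans with (2 := L), exp_pos.
Qed.

Lemma is_kx_support_sup (x : H) (r : R) : x <> hzero H -> support_sup x r ->
  is_kx H T x (Finite r).
Proof.
  intros Hx [Hub Hlub].
  assert (Hn0 : exists n j, co x n j <> RtoC 0).
  { apply NNPP. intros Hno. apply Hx, (co_eq0 H co Hco). intros n j.
    apply NNPP. intros E. apply Hno. now exists n, j. }
  assert (Hr : 0 <= r <= 1).
  { split.
    - destruct Hn0 as [n Hn]. apply Rle_trans with (rho n); [apply Hrho|]. apply Hub. now exists n.
    - apply Hlub. intros y [n [-> _]]. apply Hrho. }
  split.
  - simpl. intros M HM.
    set (A := ln (hnorm H x)).
    (* The goal is [r t ln t + 7 t + A < M (t ln t - t)]. As [t >= 1], it follows from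
       [(M - r) ln t >= 8 + |A| + M], the extra 1 giving strictness. *)
    set (B := Rmax 2 ((8 + Rabs A + M) / (M - r))).
    exists (exp (- exp B)). split; [apply exp_pos|]. intros l [Hl1 Hl2].
    set (t := - ln (Cmod l)).
    assert (Hl : Cmod l = exp (- t)) by (unfold t; rewrite Ropp_involutive, exp_ln; auto).
    assert (HB : exp B < t).
    { apply ln_increasing in Hl2; [|exact Hl1]. rewrite ln_exp in Hl2. unfold t. lra. }
    assert (HB2 : exp 2 <= t).
    { apply Rle_trans with (exp B); [|lra]. apply exp_le, Rmax_l. }
    destruct (ln_opnorm_bounds l t HB2 Hl) as [Lt [Ht1 [[D1 D2] _]]].
    pose proof (nonzero_of_exp l t Hl) as Hl0.
    assert (Lt2 : (8 + Rabs A + M) / (M - r) <= ln t).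
    { apply Rle_trans with (1 := Rmax_r 2 _). fold B.
      apply ln_ge_of_exp_le. lra. }
    assert (Lt3 : 8 + Rabs A + M <= (M - r) * ln t).
    { apply Rmult_le_compat_r with (r := M - r) in Lt2; [|lra].
      replace ((8 + Rabs A + M) / (M - r) * (M - r)) with (8 + Rabs A + M) in Lt2
        by (field; lra). lra. }
    pose proof (Rle_abs A) as LA. pose proof (Rabs_pos A) as LA'.
    destruct Hn0 as [n0 Hn0]. destruct (first_nonzero _ Hn0) as [m [Hm1 Hm2]].
    pose proof (resolvent_lead l x n0 m Hl0 Hm2) as Plow.
    assert (P : 0 < hnorm H (resolvent H T l x)).
    { apply Rlt_le_trans with (2 := Plow). apply Rdiv_lt_0_compat; [|exact Hl1].
      now apply Cmod_gt_0. }
    assert (Px : 0 < hnorm H x).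
    { apply Rlt_le_trans with (2 := co_le_hnorm H co Hco x n0 m). now apply Cmod_gt_0. }
    assert (N : ln (hnorm H (resolvent H T l x)) <= r * (t * ln t) + 7 * t + A).
    { unfold A. rewrite <- (ln_exp (r * (t * ln t) + 7 * t)), <- ln_mult by
        (try apply exp_pos; exact Px).
      apply ln_le; [exact P|]. apply resolvent_upper; try assumption.
      intros n. destruct (classic (exists j, co x n j <> RtoC 0)) as [E|E].
      - right. apply Hub. now exists n.
      - left. intros j. apply NNPP. intros E'. apply E. now exists j. }
    apply Rdiv_lt_of; [lra|]. apply Rle_lt_trans with (1 := N).
    apply Rlt_le_trans with (M * (t * ln t - t)); [|apply Rmult_le_compat_l; lra].
    assert (A <= Rabs A * t) by nra.
    assert ((8 + Rabs A + M) * t <= (M - r) * ln t * t) by nra. nra.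
  - simpl. intros m Hm d Hd.
    assert (Hn : exists n, m < rho n /\ exists j, co x n j <> RtoC 0).
    { apply NNPP. intros Hno. apply (Rlt_not_le _ _ Hm), Hlub.
      intros y [n [-> Hj]]. apply Rnot_lt_le. intros L. apply Hno. now exists n. }
    destruct Hn as [n [Hmn Hj]]. destruct (first_nonzero _ Hj) as [i0 [Hi1 Hi2]].
    set (a := Cmod (co x n i0)) in *. assert (Pa : 0 < a) by now apply Cmod_gt_0.
    (* The resonant estimate needs [rho n > 0], which [0 <= m < rho n] provides. For negative [m] a
       nonnegative numerator is enough, and this covers [rho n = 0]. *)
    destruct (Rlt_or_le m 0) as [Hm0|Hm0].
    + set (t := Rmax (exp 2) (Rmax (1 - ln d) (- ln a))).
      exists (RtoC (exp (- t))).
      assert (Hl : Cmod (RtoC (exp (- t))) = exp (- t))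
        by (rewrite Cmod_R, Rabs_right; [reflexivity|apply Rle_ge, Rlt_le, exp_pos]).
      pose proof (Rmax_r (exp 2) (Rmax (1 - ln d) (- ln a))) as M0. fold t in M0.
      pose proof (Rmax_l (1 - ln d) (- ln a)). pose proof (Rmax_r (1 - ln d) (- ln a)).
      rewrite Hl. split; [split; [apply exp_pos|]|].
      * rewrite <- (exp_ln d) by exact Hd. apply exp_increasing. lra.
      * destruct (ln_opnorm_bounds _ t (Rmax_l _ _) Hl) as [Lt [Ht1 [[D1 D2] _]]].
        pose proof (nonzero_of_exp _ t Hl) as Hl0.
        pose proof (resolvent_lead _ x n i0 Hl0 Hi2) as Plow. fold a in Plow.
        rewrite Hl in Plow.
        assert (N : 0 <= ln (hnorm H (resolvent H T (RtoC (exp (- t))) x))).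
        { apply ln_ge_of_exp_le. rewrite exp_0. apply Rle_trans with (2 := Plow).
          assert (exp (- t) <= a).
          { rewrite <- (exp_ln a) by exact Pa. apply exp_le. lra. }
          pose proof (exp_pos (- t)). apply Rmult_le_reg_r with (exp (- t)); [lra|].
          unfold Rdiv. rewrite Rmult_assoc, Rinv_l by lra. lra. }
        apply Rlt_div_of; [lra|]. nra.
    + pose proof (Hrho n) as Hrn. set (q := rho n) in *.
      destruct (solve_row_resonant q (hnorm H x) (co x n) i0 ltac:(lra) Hi2 Hi1)
        as [K HK]; [intros; apply (co_le_hnorm H co Hco)|]. fold a in HK.
      set (c := Rabs (ln (a / 2))).
      (* With [k = q ln t], the numerator bound [(k - i0) t - c] exceeds [m (t ln t + 7 t)] once
         [(q - m) ln t > i0 + 7 m + c + 1]; and [ln t = k / q >= k]. *)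
      set (B := (INR i0 + 7 * m + c + 1) / (q - m)).
      destruct (nfloor_ex (Rmax K (Rmax 2 (Rmax (1 - ln d) B)))) as [k0 [_ Hk0]].
      { apply Rle_trans with (2 := Rmax_r _ _). apply Rle_trans with (2 := Rmax_l _ _). lra. }
      set (k := S k0). rewrite <- S_INR in Hk0. fold k in Hk0.
      apply Rmax_Rlt in Hk0. destruct Hk0 as [kK Hk0].
      apply Rmax_Rlt in Hk0. destruct Hk0 as [k2 Hk0].
      apply Rmax_Rlt in Hk0. destruct Hk0 as [kd kB].
      set (t := exp (INR k / q)).
      assert (Hkq : INR k <= INR k / q).
      { apply Rmult_le_reg_r with q; [lra|]. field_simplify; [|lra]. nra. }
      assert (Hkt : INR k <= t).
      { pose proof (exp_ineq1_le (INR k / q)). unfold t. lra. }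
      exists (RtoC (exp (- t))).
      assert (Hl : Cmod (RtoC (exp (- t))) = exp (- t))
        by (rewrite Cmod_R, Rabs_right; [reflexivity|apply Rle_ge, Rlt_le, exp_pos]).
      rewrite Hl. split; [split; [apply exp_pos|]|].
      * rewrite <- (exp_ln d) by exact Hd. apply exp_increasing. lra.
      * assert (Ht2 : exp 2 <= t) by (apply exp_le; lra).
        destruct (ln_opnorm_bounds _ t Ht2 Hl) as [_ [Ht1 [[D1 D2] D3]]].
        pose proof (nonzero_of_exp _ t Hl) as Hl0.
        assert (Lt : q * ln t = INR k) by (unfold t; rewrite ln_exp; field; lra).
        set (L := ln t) in *.
        assert (N : (INR k - INR i0) * t - c
                    <= ln (hnorm H (resolvent H T (RtoC (exp (- t))) x))).
        { apply Rle_trans with (ln (a / 2 * exp ((INR k - INR i0) * t))).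
          - rewrite ln_mult, ln_exp; [|lra|apply exp_pos].
            pose proof (Rle_abs (- ln (a / 2))) as E. rewrite Rabs_Ropp in E. fold c in E. lra.
          - apply ln_le; [apply Rmult_lt_0_compat; [lra|apply exp_pos]|].
            apply Rle_trans with (1 := HK k _ (Rlt_le _ _ kK) Hl).
            apply Rle_trans with (2 := co_le_hnorm H co Hco _ n k).
            rewrite co_resolvent by exact Hl0. apply Rle_refl. }
        apply Rlt_div_of; [lra|]. apply Rlt_le_trans with (2 := N).
        apply Rle_lt_trans with (m * (t * L + 7 * t)); [apply Rmult_le_compat_l; lra|].
        rewrite <- Lt.
        assert (LB : INR i0 + 7 * m + c + 1 < (q - m) * L).
        { apply Rmult_lt_compat_r with (r := q - m) in kB; [|lra]. unfold B in kB.
          replace ((INR i0 + 7 * m + c + 1) / (q - m) * (q - m))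
            with (INR i0 + 7 * m + c + 1) in kB by (field; lra).
          assert (INR k <= L) by (unfold L, t; rewrite ln_exp; exact Hkq). nra. }
        assert (Pc : 0 <= c) by apply Rabs_pos.
        assert (c <= c * t) by nra. nra.
Qed.

Lemma power_set_support_sup (L : Rbar) :
  power_set H T L <-> exists x r, x <> hzero H /\ support_sup x r /\ L = Finite r.
Proof.
  split.
  - intros [x [Hx Hk]].
    destruct (completeness (fun y => exists n, y = rho n /\ exists j, co x n j <> RtoC 0))
      as [r Hr].
    + exists 1. intros y [n [-> _]]. apply Hrho.
    + apply NNPP. intros Hno. apply Hx, (co_eq0 H co Hco). intros n j.
      apply NNPP. intros E. apply Hno. exists (rho n), n. split; [reflexivity|now exists j].
    + exists x, r. repeat split; try assumption; try apply Hr.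
      apply (is_limsup0_unique _ _ _ Hk). now apply is_kx_support_sup.
  - intros [x [r [Hx [Hr ->]]]]. exists x. split; [exact Hx|]. now apply is_kx_support_sup.
Qed.

(** The coefficients [(/ 2) ^ n] keep the vector square summable even when infinitely many summands
    are prescribed. *)
Lemma support_vector (P : nat -> Prop) : exists x : H,
  forall n, (exists j, co x n j <> RtoC 0) <-> P n.
Proof.
  set (f := fun n j : nat => match j with
    | O => if excluded_middle_informative (P n) then RtoC ((/ 2) ^ n) else RtoC 0
    | S _ => RtoC 0
    end).
  assert (Hf : forall N, sqsum N f <= 2).
  { intros N. apply Rle_trans with (rsum N (fun n => (/ 2) ^ n)).
    - apply rsum_le. intros n _.
      assert (Hn : 0 < (/ 2) ^ n <= 1).
      { split; [apply pow_lt; lra|]. rewrite <- (pow1 n). apply pow_incr. lra. }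
      assert (E : forall M, rsum M (fun j => Cmod (f n j) ^ 2) <= Cmod (f n O) ^ 2).
      { induction M as [|[|M] IH]; [apply pow2_ge_0|simpl; lra|].
        change (rsum (S (S M)) ?g) with (rsum (S M) g + g (S M)). cbv beta.
        change (f n (S M)) with (RtoC 0). rewrite Cmod_0. lra. }
      apply Rle_trans with (1 := E N). simpl f.
      destruct (excluded_middle_informative (P n)).
      + rewrite Cmod_R, Rabs_right by lra. nra.
      + rewrite Cmod_0. lra.
    - assert (E : rsum N (fun n => (/ 2) ^ n) = 2 - 2 * (/ 2) ^ N).
      { induction N as [|N IH]; simpl; [ring|]. rewrite IH. field. }
      rewrite E. pose proof (pow_lt (/ 2) N ltac:(lra)). lra. }
  destruct (co_surj _ _ Hco f 2 Hf) as [x Hx]. exists x. intros n. split.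
  - intros [j Hj]. rewrite Hx in Hj. destruct j as [|j]; simpl in Hj; [|congruence].
    destruct (excluded_middle_informative (P n)); [assumption|congruence].
  - intros Hn. exists O. rewrite Hx. simpl.
    destruct (excluded_middle_informative (P n)); [|contradiction].
    intros E. injection E. pose proof (pow_lt (/ 2) n ltac:(lra)). lra.
Qed.

End WeightedShift.

Theorem theoremB (H : CHilbert) (sigma : R -> Prop) :
  right_closed sigma ->
  (forall r, sigma r -> 0 <= r <= 1) ->
  sigma 1 ->
  exists T : H -> H, quasinilpotent H T /\
    (forall L : Rbar, power_set H T L <-> exists r, L = Finite r /\ sigma r).
Proof.
  intros [_ Hsup] H01 H1.
  destruct (countable_left_dense sigma (fun r Hr => proj1 (H01 r Hr)) H1)
    as [rho [R0 [Rs Rd]]].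
  destruct (coordinates_exist H) as [co Hco].
  assert (Hrho : forall n, 0 <= rho n <= 1) by auto.
  destruct (operator_of_coordinates H co Hco (shift (fun n => weight (rho n))) 1)
    as [T [HT coT]].
  { intros a f g h E n [|j]; simpl; [|rewrite E]; ring. }
  { lra. }
  { intros f N. apply shift_sqsum. intros; apply weight_bounds. }
  exists T. split; [now apply (weighted_shift_quasinilpotent H co Hco rho)|].
  intros L. rewrite (power_set_support_sup H co Hco rho) by assumption. split.
  - intros [x [r [Hx [Hr ->]]]]. exists r. split; [reflexivity|].
    apply (Hsup (fun y => exists n, y = rho n /\ exists j, co x n j <> RtoC 0)).
    + intros y [n [-> _]]. apply Rs.
    + apply NNPP. intros Hno. apply Hx, (co_eq0 H co Hco). intros n j.
      apply NNPP. intros E. apply Hno. exists (rho n), n. split; [reflexivity|now exists j].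
    + exists 0, 1. intros y [n [-> _]]. apply Hrho.
    + exact Hr.
  - intros [s [-> Hs]].
    destruct (support_vector H co Hco (fun n => rho n <= s)) as [x Hx].
    exists x, s. repeat split.
    (* Any number below [s] would do here: some [rho n <= s] exists, so the vector is nonzero. *)
    + intros E. destruct (Rd s (s - 1) Hs) as [n [_ Hn]]; [lra|].
      apply Hx in Hn. destruct Hn as [j Hj]. apply Hj. rewrite E.
      now apply (co_zero H co).
    + intros y [n [-> Hj]]. now apply Hx.
    + intros b Hb. apply Rnot_lt_le. intros Hbs.
      destruct (Rd s b Hs Hbs) as [n [N1 N2]].
      apply (Rlt_not_le _ _ N1), Hb. exists n. split; [reflexivity|now apply Hx].
Qed.
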